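(* For every $\beta \in \Bbbk$, the ring $B_\beta$ is (left and right) noetherian, where $B_\beta$ is the image of $U(W_\Gamma)$ under the composition of $\Phi: U(W_\Gamma) \to T$ with the quotient map $T \to T/(b-\beta)T \cong \Bbbk[a]\rtimes\Gamma$.
   Context: $\Bbbk$ is an algebraically closed field of characteristic zero and $\Gamma$ is a finitely generated additive subgroup of $\Bbbk$. $W_\Gamma$ is the Lie algebra over $\Bbbk$ with basis $\{e_\nu \mid \nu \in \Gamma\}$ and bracket $[e_\mu, e_\nu] = (\nu - \mu) e_{\nu+\mu}$; $U(W_\Gamma)$ is its enveloping algebra. $T = \Bbbk[a,b]\rtimes\Gamma = \bigoplus_{\gamma\in\Gamma}\Bbbk[a,b]t^\gamma$, with $t^\gamma t^\delta = t^{\gamma+\delta}$ and $t^\gamma p(a,b) = p(a+\gamma,b)t^\gamma$ (so $b$ is central in $T$); similarly $\Bbbk[a]\rtimes\Gamma = \bigoplus_{\gamma}\Bbbk[a]t^\gamma$ with $t^\gamma p(a) = p(a+\gamma)t^\gamma$. $\Phi: U(W_\Gamma)\to T$ is the algebra anti-homomorphism with $\Phi(e_\mu) = (a+b\mu)t^\mu$ for $\mu \in \Gamma$. Thus $B_\beta$ is the subalgebra of $\Bbbk[a]\rtimes\Gamma$ generated by the elements $(a+\beta\mu)t^\mu$, $\mu\in\Gamma$. *)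

(* Defs.v *)
From HB Require Import structures.
From mathcomp Require Import all_boot all_order all_algebra.
From mathcomp Require Import finmap boolp ring.
From mathcomp.multinomials Require Import mpoly monalg.

Set Implicit Arguments.
Unset Strict Implicit.
Unset Printing Implicit Defensive.

Import GRing.Theory.

Local Open Scope fset_scope.
Local Open Scope ring_scope.
Local Open Scope quotient_scope.

(* The converse of an algebra, so that an algebra anti-homomorphism into A is *)
(* an algebra homomorphism into A^c.                                          *)

Section ConverseAlgebra.
Variables (R : nzRingType) (A : algType R).

HB.instance Definition _ :=
  GRing.Zmodule_isLmodule.Build R A^c
    (@scalerA R A) (@scale1r R A) (@scalerDr R A) (fun v a b => scalerDl v a b).

Fact converse_scalerAl (a : R) (u v : A^c) : a *: (u * v) = (a *: u) * v.
Proof. exact: (@scalerAr R A a v u). Qed.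

Fact converse_scalerAr (a : R) (u v : A^c) : a *: (u * v) = u * (a *: v).
Proof. exact: (@scalerAl R A a v u). Qed.

HB.instance Definition _ :=
  GRing.Lmodule_isLalgebra.Build R A^c converse_scalerAl.
HB.instance Definition _ :=
  GRing.Lalgebra_isAlgebra.Build R A^c converse_scalerAr.

End ConverseAlgebra.

HB.mixin Record Lmodule_isLie (R : nzRingType) L of GRing.Lmodule R L := {
  lieb : L -> L -> L;
  liebDl : left_distributive lieb +%R;
  liebDr : right_distributive lieb +%R;
  liebZl : forall (c : R) x y, lieb (c *: x) y = c *: lieb x y;
  liebZr : forall (c : R) x y, lieb x (c *: y) = c *: lieb x y;
  liebxx : forall x, lieb x x = 0;
  lieb_jacobi : forall x y z,
    lieb x (lieb y z) + lieb y (lieb z x) + lieb z (lieb x y) = 0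
}.

#[short(type="lieType")]
HB.structure Definition LieAlgebra (R : nzRingType) :=
  {L of GRing.Lmodule R L & Lmodule_isLie R L}.

Definition lie_morphism (R : nzRingType) (L : lieType R) (A : algType R)
    (f : L -> A) : Prop :=
  [/\ {morph f : x y / x + y}, forall c : R, {morph f : x / c *: x}
    & forall x y, f (lieb x y) = f x * f y - f y * f x].

(* The enveloping algebra of a Lie algebra L: the unital associative algebra  *)
(* generated by the module L subject to xy - yx = [x, y], built as the        *)
(* quotient of formal expressions by the least congruence containing the      *)
(* algebra axioms and these relations.                                        *)

Section EnvelopingAlgebra.
Variables (R : comNzRingType) (L : lieType R).

Inductive uterm :=
| UGen of L
| UZero
| UOne
| UAdd of uterm & uterm
| UMul of uterm & uterm
| UScale of R & uterm.

Fixpoint uterm_encode (t : uterm) : GenTree.tree (L + R) :=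
  match t with
  | UGen x => GenTree.Leaf (inl x)
  | UZero => GenTree.Node 0 [::]
  | UOne => GenTree.Node 1 [::]
  | UAdd s t => GenTree.Node 2 [:: uterm_encode s; uterm_encode t]
  | UMul s t => GenTree.Node 3 [:: uterm_encode s; uterm_encode t]
  | UScale c t => GenTree.Node 4 [:: GenTree.Leaf (inr c); uterm_encode t]
  end.

Fixpoint uterm_decode (t : GenTree.tree (L + R)) : uterm :=
  match t with
  | GenTree.Leaf (inl x) => UGen x
  | GenTree.Node 1 [::] => UOne
  | GenTree.Node 2 [:: s; t] => UAdd (uterm_decode s) (uterm_decode t)
  | GenTree.Node 3 [:: s; t] => UMul (uterm_decode s) (uterm_decode t)
  | GenTree.Node 4 [:: GenTree.Leaf (inr c); t] => UScale c (uterm_decode t)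
  | _ => UZero
  end.

Fact uterm_encodeK : cancel uterm_encode uterm_decode.
Proof. by elim=> //= [s -> t ->|s -> t ->|c t ->]. Qed.

HB.instance Definition _ := Equality.copy uterm (can_type uterm_encodeK).
HB.instance Definition _ := Choice.copy uterm (can_type uterm_encodeK).

Inductive ueq : uterm -> uterm -> Prop :=
| ueq_refl t : ueq t t
| ueq_sym s t : ueq s t -> ueq t s
| ueq_trans s t u : ueq s t -> ueq t u -> ueq s u
| ueq_add s s' t t' : ueq s s' -> ueq t t' -> ueq (UAdd s t) (UAdd s' t')
| ueq_mul s s' t t' : ueq s s' -> ueq t t' -> ueq (UMul s t) (UMul s' t')
| ueq_scale c t t' : ueq t t' -> ueq (UScale c t) (UScale c t')
| ueq_addA s t u : ueq (UAdd s (UAdd t u)) (UAdd (UAdd s t) u)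
| ueq_addC s t : ueq (UAdd s t) (UAdd t s)
| ueq_add0 t : ueq (UAdd UZero t) t
| ueq_addN t : ueq (UAdd (UScale (-1) t) t) UZero
| ueq_mulA s t u : ueq (UMul s (UMul t u)) (UMul (UMul s t) u)
| ueq_mul1l t : ueq (UMul UOne t) t
| ueq_mul1r t : ueq (UMul t UOne) t
| ueq_mulDl s t u : ueq (UMul (UAdd s t) u) (UAdd (UMul s u) (UMul t u))
| ueq_mulDr s t u : ueq (UMul s (UAdd t u)) (UAdd (UMul s t) (UMul s u))
| ueq_scaleA c d t : ueq (UScale c (UScale d t)) (UScale (c * d) t)
| ueq_scale1 t : ueq (UScale 1 t) t
| ueq_scaleDr c s t : ueq (UScale c (UAdd s t)) (UAdd (UScale c s) (UScale c t))
| ueq_scaleDl c d t : ueq (UScale (c + d) t) (UAdd (UScale c t) (UScale d t))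
| ueq_scaleAl c s t : ueq (UScale c (UMul s t)) (UMul (UScale c s) t)
| ueq_scaleAr c s t : ueq (UScale c (UMul s t)) (UMul s (UScale c t))
| ueq_genD x y : ueq (UGen (x + y)) (UAdd (UGen x) (UGen y))
| ueq_genZ c x : ueq (UGen (c *: x)) (UScale c (UGen x))
| ueq_genL x y : ueq (UGen (lieb x y))
    (UAdd (UMul (UGen x) (UGen y)) (UScale (-1) (UMul (UGen y) (UGen x)))).

Definition ueqb (s t : uterm) : bool := `[< ueq s t >].

Fact ueqb_refl : reflexive ueqb.
Proof. by move=> t; apply/asboolP/ueq_refl. Qed.

Fact ueqb_sym s t : ueqb s t = ueqb t s.
Proof. by apply/asboolP/asboolP; apply: ueq_sym. Qed.

Fact ueqb_trans : transitive ueqb.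
Proof.
by move=> t s u /asboolP st /asboolP tu; apply/asboolP/(ueq_trans st tu).
Qed.

Canonical ueq_equiv := EquivRel ueqb ueqb_refl ueqb_sym ueqb_trans.

Definition envelop := {eq_quot ueq_equiv}.

HB.instance Definition _ := EqQuotient.on envelop.
HB.instance Definition _ := Choice.on envelop.

Definition upi (t : uterm) : envelop := \pi_envelop t.

Lemma upi_eq s t : upi s = upi t <-> ueq s t.
Proof. by split=> [/eqmodP/asboolP|st] //; apply/eqmodP/asboolP. Qed.

Lemma upi_repr (u : envelop) : upi (repr u) = u.
Proof. exact: reprK. Qed.

Lemma repr_upi t : ueq (repr (upi t)) t.
Proof. by apply/upi_eq; rewrite upi_repr. Qed.

Definition uadd (u v : envelop) := upi (UAdd (repr u) (repr v)).
Definition umul (u v : envelop) := upi (UMul (repr u) (repr v)).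
Definition uscale (c : R) (u : envelop) := upi (UScale c (repr u)).

Lemma upiD s t : upi (UAdd s t) = uadd (upi s) (upi t).
Proof. by apply/upi_eq/ueq_sym/ueq_add; apply: repr_upi. Qed.

Lemma upiM s t : upi (UMul s t) = umul (upi s) (upi t).
Proof. by apply/upi_eq/ueq_sym/ueq_mul; apply: repr_upi. Qed.

Lemma upiZ c t : upi (UScale c t) = uscale c (upi t).
Proof. by apply/upi_eq/ueq_sym/ueq_scale/repr_upi. Qed.

Let upiE := (upiD, upiM, upiZ).

Lemma envelop_ind (P : envelop -> Prop) :
  (forall t, P (upi t)) -> forall u, P u.
Proof. by move=> Pt u; rewrite -[u]upi_repr. Qed.

Ltac uelim := do ![elim/envelop_ind=> ?]; rewrite -?upiE; apply/upi_eq.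

Fact uaddA : associative uadd.
Proof. by uelim; apply: ueq_addA. Qed.
Fact uaddC : commutative uadd.
Proof. by uelim; apply: ueq_addC. Qed.
Fact uadd0 : left_id (upi UZero) uadd.
Proof. by uelim; apply: ueq_add0. Qed.
Fact uaddN : left_inverse (upi UZero) (uscale (-1)) uadd.
Proof. by uelim; apply: ueq_addN. Qed.

HB.instance Definition _ :=
  GRing.isZmodule.Build envelop uaddA uaddC uadd0 uaddN.

Section Eval.
Variables (A : algType R) (f : L -> A).

Fixpoint ueval (t : uterm) : A :=
  match t with
  | UGen x => f x
  | UZero => 0
  | UOne => 1
  | UAdd s t => ueval s + ueval t
  | UMul s t => ueval s * ueval t
  | UScale c t => c *: ueval t
  end.

Lemma ueval_ueq s t : lie_morphism f -> ueq s t -> ueval s = ueval t.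
Proof.
case=> fD fZ fL; elim=> //= {s t}.
- by move=> s t u _ -> _ ->.
- by move=> s s' t t' _ -> _ ->.
- by move=> s s' t t' _ -> _ ->.
- by move=> c t t' _ ->.
- by move=> *; rewrite addrA.
- by move=> *; rewrite addrC.
- by move=> *; rewrite add0r.
- by move=> *; rewrite scaleN1r addNr.
- by move=> *; rewrite mulrA.
- by move=> *; rewrite mul1r.
- by move=> *; rewrite mulr1.
- by move=> *; rewrite mulrDl.
- by move=> *; rewrite mulrDr.
- by move=> *; rewrite scalerA.
- by move=> *; rewrite scale1r.
- by move=> *; rewrite scalerDr.
- by move=> *; rewrite scalerDl.
- by move=> *; rewrite scalerAl.
- by move=> *; rewrite scalerAr.
- by move=> *; rewrite fL scaleN1r.
Qed.

End Eval.

Fact umulA : associative umul.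
Proof. by uelim; apply: ueq_mulA. Qed.
Fact umul1l : left_id (upi UOne) umul.
Proof. by uelim; apply: ueq_mul1l. Qed.
Fact umul1r : right_id (upi UOne) umul.
Proof. by uelim; apply: ueq_mul1r. Qed.
Fact umulDl : left_distributive umul uadd.
Proof. by uelim; apply: ueq_mulDl. Qed.
Fact umulDr : right_distributive umul uadd.
Proof. by uelim; apply: ueq_mulDr. Qed.
Fact uone_neq0 : upi UOne != 0.
Proof.
apply/eqP=> /upi_eq; pose f (_ : L) : R^o := 0.
have f_lie : lie_morphism f.
  by split=> [x y|c x|x y]; rewrite /f ?addr0 ?scaler0 ?mulr0 ?subr0.
by move=> /(ueval_ueq f_lie) /= /eqP; rewrite oner_eq0.
Qed.

HB.instance Definition _ := GRing.Zmodule_isNzRing.Build envelop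
  umulA umul1l umul1r umulDl umulDr uone_neq0.

Fact uscaleA c d u : uscale c (uscale d u) = uscale (c * d) u.
Proof.
by elim/envelop_ind: u => t; rewrite -!upiE; apply/upi_eq/ueq_scaleA.
Qed.
Fact uscale1 : left_id 1 uscale.
Proof. by uelim; apply: ueq_scale1. Qed.
Fact uscaleDr : right_distributive uscale uadd.
Proof. by move=> c; uelim; apply: ueq_scaleDr. Qed.
Fact uscaleDl u : {morph uscale^~ u : c d / c + d >-> uadd c d}.
Proof.
move=> c d; elim/envelop_ind: u => t; rewrite -!upiE.
exact/upi_eq/ueq_scaleDl.
Qed.

HB.instance Definition _ := GRing.Zmodule_isLmodule.Build R envelop
  uscaleA uscale1 uscaleDr uscaleDl.

Fact uscaleAl c u v : uscale c (umul u v) = umul (uscale c u) v.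
Proof.
elim/envelop_ind: u => s; elim/envelop_ind: v => t; rewrite -!upiE.
exact/upi_eq/ueq_scaleAl.
Qed.
Fact uscaleAr c u v : uscale c (umul u v) = umul u (uscale c v).
Proof.
elim/envelop_ind: u => s; elim/envelop_ind: v => t; rewrite -!upiE.
exact/upi_eq/ueq_scaleAr.
Qed.

HB.instance Definition _ := GRing.Lmodule_isLalgebra.Build R envelop uscaleAl.
HB.instance Definition _ := GRing.Lalgebra_isAlgebra.Build R envelop uscaleAr.

Definition ugen (x : L) : envelop := upi (UGen x).

Lemma ugen_lie : lie_morphism ugen.
Proof.
split=> [x y|c x|x y].
- by rewrite [RHS](esym (upiD _ _)); apply/upi_eq/ueq_genD.
- by rewrite [RHS](esym (upiZ _ _)); apply/upi_eq/ueq_genZ.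
rewrite [_ * _](esym (upiM _ _)) [ugen y * _](esym (upiM _ _)).
by rewrite [- _](esym (upiZ _ _)) [RHS](esym (upiD _ _)); apply/upi_eq/ueq_genL.
Qed.

Lemma envelop_gen_ind (P : envelop -> Prop) :
  (forall x, P (ugen x)) -> P 0 -> P 1 ->
  (forall u v, P u -> P v -> P (u + v)) ->
  (forall u v, P u -> P v -> P (u * v)) ->
  (forall (c : R) u, P u -> P (c *: u)) ->
  forall u, P u.
Proof.
move=> Pg P0 P1 PD PM PZ; elim/envelop_ind; elim=> //.
- by move=> s Ps t Pt; rewrite upiD; apply: PD.
- by move=> s Ps t Pt; rewrite upiM; apply: PM.
- by move=> c t Pt; rewrite upiZ; apply: PZ.
Qed.

Section Lift.
Variables (A : algType R) (f : L -> A) (f_lie : lie_morphism f).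

Definition ulift (u : envelop) : A := ueval f (repr u).

Lemma ulift_upi t : ulift (upi t) = ueval f t.
Proof. exact/ueval_ueq/repr_upi. Qed.

Lemma ulift_gen x : ulift (ugen x) = f x.
Proof. exact: ulift_upi. Qed.

Lemma uliftD : {morph ulift : u v / u + v}.
Proof. by move=> u v; rewrite [LHS]ulift_upi. Qed.

Lemma uliftM : {morph ulift : u v / u * v}.
Proof. by move=> u v; rewrite [LHS]ulift_upi. Qed.

Lemma ulift1 : ulift 1 = 1.
Proof. by rewrite [LHS]ulift_upi. Qed.

Lemma uliftZ (c : R) : {morph ulift : u / c *: u}.
Proof. by move=> u; rewrite [LHS]ulift_upi. Qed.

Lemma ulift_uniq (g : {lrmorphism envelop -> A}) :
  (forall x, g (ugen x) = f x) -> g =1 ulift.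
Proof.
move=> gf; elim/envelop_gen_ind=> [x|||u v Eu Ev|u v Eu Ev|c u Eu].
- by rewrite gf ulift_gen.
- by rewrite rmorph0 [RHS]ulift_upi.
- by rewrite rmorph1 ulift1.
- by rewrite uliftD -Eu -Ev; apply: rmorphD.
- by rewrite uliftM -Eu -Ev; apply: rmorphM.
- by rewrite uliftZ -Eu; apply: linearZ.
Qed.

End Lift.

End EnvelopingAlgebra.

(* mpoly and monalg both define these two notations. *)
Local Notation "g @_ k" := (monalg.mcoeff k g) : ring_scope.
Local Notation "{ 'mpoly' R [ n ] }" := (mpoly.mpoly n R) : type_scope.

Section FinitelySupported.
Variables (K : choiceType) (G V : zmodType).
Implicit Types (f g : {malg G[K]}) (h : K -> G -> V).

Definition mext h f : V := \sum_(k <- msupp f) h k f@_k.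

Lemma mextD h : (forall k, {morph h k : x y / x + y}) ->
  {morph mext h : f g / f + g}.
Proof.
move=> hD f g; have h0 k : h k 0 = 0.
  by apply: (addrI (h k 0)); rewrite -hD !addr0.
have mextw (d : {fset K}) e : msupp e `<=` d ->
    mext h e = \sum_(k <- d) h k e@_k.
  move=> le_d; rewrite /mext (big_fset_incl _ le_d) // => k _.
  by move/mcoeff_outdom ->.
rewrite (mextw _ _ (msuppD_le f g)) (mextw _ _ (fsubsetUl _ (msupp g))).
rewrite (mextw _ _ (fsubsetUr (msupp f) _)) -big_split.
by apply: eq_bigr => k _; rewrite mcoeffD hD.
Qed.

Lemma mext0 h : mext h 0 = 0.
Proof. by rewrite /mext msupp0 big_seq_fset0. Qed.

Lemma mextU h k x : h k 0 = 0 -> mext h << x *g k >> = h k x.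
Proof.
rewrite /mext msuppU; have [-> ->|_ _] := eqVneq x 0.
  by rewrite big_seq_fset0.
by rewrite big_seq_fset1 mcoeffUU.
Qed.

Lemma eq_mext h h' f : (forall k x, h k x = h' k x) -> mext h f = mext h' f.
Proof. by move=> hE; apply: eq_bigr. Qed.

Lemma mext_split h h' f :
  mext (fun k x => h k x + h' k x) f = mext h f + mext h' f.
Proof. exact: big_split. Qed.

Lemma mext_eq0 f : mext (fun _ _ => 0) f = 0.
Proof. exact: big1. Qed.

End FinitelySupported.

Lemma malg_ind (K : choiceType) (G : zmodType) (P : {malg G[K]} -> Prop) :
  (forall x k, P << x *g k >>) -> P 0 ->
  (forall f g, P f -> P g -> P (f + g)) -> forall f, P f.
Proof. by move=> PU P0 PD f; rewrite [f]monalgE; elim/big_ind: _. Qed.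

Lemma malg_scaleU (K : choiceType) (R : nzRingType) (c d : R) (k : K) :
  c *: (<< d *g k >> : {malg R[K]}) = << c * d *g k >>.
Proof. by apply/malgP => j; rewrite mcoeffZ !mcoeffU mulrnAr. Qed.

(* The skew group ring A ⋊ G of an action s of an additive group G on an      *)
(* algebra A by algebra endomorphisms (automatically automorphisms): the      *)
(* element << p *g d >> stands for p t^d, so that t^d p = s_d(p) t^d.         *)

Record algAction (R : nzRingType) (A : algType R) (G : zmodType) := AlgAction {
  act :> G -> {lrmorphism A -> A};
  act0 : act 0 =1 id;
  actD : forall d e, act (d + e) =1 act d \o act e
}.

Section SkewGroupRing.
Variables (R : nzRingType) (A : algType R) (G : zmodType) (s : algAction A G).

Definition skew of algAction A G : Type := {malg A[G]}.
Local Notation S := (skew s).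

HB.instance Definition _ := GRing.Zmodule.copy S {malg A[G]}.

Definition skew_one : S := << 1 *g 0 >>.

(* The operations are locked to keep conversion from unfolding them.          *)
Fact skew_key : unit. Proof. by []. Qed.

Definition skew_mul : S -> S -> S := locked_with skew_key (fun f g =>
  \sum_(d <- msupp f) \sum_(e <- msupp g) << f@_d * s d g@_e *g d + e >>).

Definition skew_scale : R -> S -> S := locked_with skew_key (fun c f =>
  \sum_(d <- msupp f) << c *: f@_d *g d >>).

Let mulk (g : S) (d : G) (p : A) : S :=
  mext (fun e q => << p * s d q *g d + e >>) g.

Let skew_mulE f g : skew_mul f g = mext (mulk g) f.
Proof. by rewrite /skew_mul unlock. Qed.

Let scalek (c : R) (d : G) (p : A) : S := << c *: p *g d >>.

Let skew_scaleE c f : skew_scale c f = mext (scalek c) f.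
Proof. by rewrite /skew_scale unlock. Qed.

Fact skew_mulDr : right_distributive skew_mul +%R.
Proof.
move=> f g h; rewrite !skew_mulE -mext_split; apply: eq_mext => d x.
by apply: mextD => e y z; rewrite rmorphD mulrDr monalgUD.
Qed.

Fact skew_mulDl : left_distributive skew_mul +%R.
Proof.
move=> f g h; rewrite !skew_mulE; apply: mextD => d x y.
rewrite /mulk -mext_split; apply: eq_mext => e z.
by rewrite mulrDl monalgUD.
Qed.

Fact skew_mul0 f : skew_mul f 0 = 0.
Proof. by apply: (addrI (skew_mul f 0)); rewrite -skew_mulDr !addr0. Qed.

Fact skew_0mul f : skew_mul 0 f = 0.
Proof. by apply: (addrI (skew_mul 0 f)); rewrite -skew_mulDl !addr0. Qed.

Lemma skew_mulUU p q d e :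
  skew_mul << p *g d >> << q *g e >> = << p * s d q *g d + e >>.
Proof.
rewrite skew_mulE mextU; last first.
  rewrite -[RHS](mext_eq0 S << q *g e >>); apply: eq_mext => *.
  by rewrite mul0r monalgU0.
by rewrite /mulk mextU // rmorph0 mulr0 monalgU0.
Qed.

Fact skew_mulA : associative skew_mul.
Proof.
move=> f g h; elim/malg_ind: f => [p c||f f' IH IH']; first last.
- by rewrite !skew_mulDl IH IH'.
- by rewrite !skew_0mul.
elim/malg_ind: g => [q d||f f' IH IH']; first last.
- by rewrite skew_mulDl !skew_mulDr skew_mulDl IH IH'.
- by rewrite skew_0mul !skew_mul0 skew_0mul.
elim/malg_ind: h => [r e||f f' IH IH']; first last.
- by rewrite !skew_mulDr IH IH'.
- by rewrite !skew_mul0.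
by rewrite !skew_mulUU actD rmorphM mulrA addrA.
Qed.

Fact skew_mul1l : left_id skew_one skew_mul.
Proof.
move=> f; elim/malg_ind: f => [p d||f g Ef Eg].
- by rewrite skew_mulUU act0 mul1r add0r.
- by rewrite skew_mul0.
- by rewrite skew_mulDr Ef Eg.
Qed.

Fact skew_mul1r : right_id skew_one skew_mul.
Proof.
move=> f; elim/malg_ind: f => [p d||f g Ef Eg].
- by rewrite skew_mulUU rmorph1 mulr1 addr0.
- by rewrite skew_0mul.
- by rewrite skew_mulDl Ef Eg.
Qed.

Fact skew_one_neq0 : skew_one != 0.
Proof. by rewrite monalgU_eq0 oner_eq0. Qed.

HB.instance Definition _ := GRing.Zmodule_isNzRing.Build S
  skew_mulA skew_mul1l skew_mul1r skew_mulDl skew_mulDr skew_one_neq0.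

Fact skew_scaleDr : right_distributive skew_scale +%R.
Proof.
move=> c f g; rewrite !skew_scaleE; apply: mextD => d x y.
by rewrite /scalek scalerDr monalgUD.
Qed.

Fact skew_scaleDl f : {morph skew_scale^~ f : c d / c + d}.
Proof.
move=> c c'; rewrite !skew_scaleE -mext_split; apply: eq_mext => d x.
by rewrite /scalek scalerDl monalgUD.
Qed.

Fact skew_scale0 c : skew_scale c 0 = 0.
Proof. by rewrite skew_scaleE mext0. Qed.

Lemma skew_scaleU c p d : skew_scale c << p *g d >> = << c *: p *g d >>.
Proof. by rewrite skew_scaleE mextU // /scalek scaler0 monalgU0. Qed.

Fact skew_scaleA c c' f :
  skew_scale c (skew_scale c' f) = skew_scale (c * c') f.
Proof.
elim/malg_ind: f => [p d||f g Ef Eg].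
- by rewrite !skew_scaleU scalerA.
- by rewrite !skew_scale0.
- by rewrite !skew_scaleDr Ef Eg.
Qed.

Fact skew_scale1 : left_id 1 skew_scale.
Proof.
move=> f; elim/malg_ind: f => [p d||f g Ef Eg].
- by rewrite skew_scaleU scale1r.
- by rewrite skew_scale0.
- by rewrite skew_scaleDr Ef Eg.
Qed.

HB.instance Definition _ := GRing.Zmodule_isLmodule.Build R S
  skew_scaleA skew_scale1 skew_scaleDr skew_scaleDl.

Lemma skewM p q d e :
  (<< p *g d >> : S) * << q *g e >> = << p * s d q *g d + e >>.
Proof. exact: skew_mulUU. Qed.

Lemma skewZ (c : R) p d : c *: (<< p *g d >> : S) = << c *: p *g d >>.
Proof. exact: skew_scaleU. Qed.

Lemma skew_ind (P : S -> Prop) :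
  (forall p d, P << p *g d >>) -> P 0 ->
  (forall f g, P f -> P g -> P (f + g)) -> forall f, P f.
Proof. exact: malg_ind. Qed.

Fact skew_scaleAl (c : R) (f g : S) : c *: (f * g) = (c *: f) * g.
Proof.
elim/skew_ind: f => [p d||f f' IH IH']; first last.
- by rewrite scalerDr !mulrDl scalerDr IH IH'.
- by rewrite scaler0 !mul0r scaler0.
elim/skew_ind: g => [q e||f f' IH IH']; first last.
- by rewrite !mulrDr scalerDr IH IH'.
- by rewrite !mulr0 scaler0.
by rewrite skewZ !skewM skewZ scalerAl.
Qed.

Fact skew_scaleAr (c : R) (f g : S) : c *: (f * g) = f * (c *: g).
Proof.
elim/skew_ind: f => [p d||f f' IH IH']; first last.
- by rewrite !mulrDl scalerDr IH IH'.
- by rewrite !mul0r scaler0.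
elim/skew_ind: g => [q e||f f' IH IH']; first last.
- by rewrite scalerDr !mulrDr scalerDr IH IH'.
- by rewrite scaler0 !mulr0 scaler0.
by rewrite skewZ !skewM skewZ scalerAr linearZ.
Qed.

HB.instance Definition _ := GRing.Lmodule_isLalgebra.Build R S skew_scaleAl.
HB.instance Definition _ := GRing.Lalgebra_isAlgebra.Build R S skew_scaleAr.

End SkewGroupRing.

Section Subgroup.
Variables (V : zmodType) (S : zmodClosed V).

Definition zsub : Type := {x : V | x \in S}.

HB.instance Definition _ := SubType.on zsub.
HB.instance Definition _ := Choice.on zsub.
HB.instance Definition _ := [SubChoice_isSubZmodule of zsub by <:].

Definition fin_gen : Prop :=
  exists s : seq V, forall x : V,
    x \in S <->
    exists c : 'I_(size s) -> int, x = \sum_(i < size s) s`_i *~ c i.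

Definition zsub_val : {additive zsub -> V} := \val.

End Subgroup.

(* W_Γ, for Γ the image of an additive group G under i : G -> k;              *)
(* << c *g mu >> stands for c e_mu.                                           *)

Section Witt.
Variables (k : fieldType) (G : zmodType) (i : {additive G -> k}).

Definition witt of {additive G -> k} : Type := {malg k[G]}.
Local Notation W := (witt i).

HB.instance Definition _ := GRing.Lmodule.copy W {malg k[G]}.

Definition witt_e (mu : G) : W := << 1 *g mu >>.

Fact witt_key : unit. Proof. by []. Qed.

Definition witt_bracket : W -> W -> W := locked_with witt_key (fun x y =>
  \sum_(mu <- msupp x) \sum_(nu <- msupp y)
    << x@_mu * y@_nu * (i nu - i mu) *g nu + mu >>).

Let brk (y : W) (mu : G) (c : k) : W :=
  mext (fun nu d => << c * d * (i nu - i mu) *g nu + mu >>) y.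

Let witt_bracketE x y : witt_bracket x y = mext (brk y) x.
Proof. by rewrite /witt_bracket unlock. Qed.

Lemma witt_ind (P : W -> Prop) :
  (forall c mu, P << c *g mu >>) -> P 0 ->
  (forall x y, P x -> P y -> P (x + y)) -> forall x, P x.
Proof. exact: malg_ind. Qed.

Fact witt_bracketDl : left_distributive witt_bracket +%R.
Proof.
move=> x y z; rewrite !witt_bracketE; apply: mextD => mu c d.
rewrite /brk -mext_split; apply: eq_mext => nu e.
by rewrite !mulrDl monalgUD.
Qed.

Fact witt_bracketDr : right_distributive witt_bracket +%R.
Proof.
move=> x y z; rewrite !witt_bracketE -mext_split; apply: eq_mext => mu c.
by apply: mextD => nu d e; rewrite [c * _]mulrDr mulrDl monalgUD.
Qed.

Lemma witt_bracketUU c d mu nu :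
  witt_bracket << c *g mu >> << d *g nu >>
  = << c * d * (i nu - i mu) *g nu + mu >>.
Proof.
rewrite witt_bracketE mextU; last first.
  rewrite -[RHS](mext_eq0 W << d *g nu >>); apply: eq_mext => *.
  by rewrite !mul0r monalgU0.
by rewrite /brk mextU // mulr0 mul0r monalgU0.
Qed.

Lemma witt_scaleU (c d : k) mu :
  c *: (<< d *g mu >> : W) = << c * d *g mu >>.
Proof. exact: malg_scaleU. Qed.

Fact witt_bracket0l x : witt_bracket 0 x = 0.
Proof.
by apply: (addrI (witt_bracket 0 x)); rewrite -witt_bracketDl !addr0.
Qed.

Fact witt_bracket0r x : witt_bracket x 0 = 0.
Proof.
by apply: (addrI (witt_bracket x 0)); rewrite -witt_bracketDr !addr0.
Qed.

Fact witt_bracketZl (c : k) x y :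
  witt_bracket (c *: x) y = c *: witt_bracket x y.
Proof.
elim/witt_ind: x => [a mu||x x' IH IH']; first last.
- rewrite [in LHS]scalerDr [in LHS]witt_bracketDl [in RHS]witt_bracketDl.
  by rewrite [RHS]scalerDr; apply: (f_equal2 +%R IH IH').
- by rewrite scaler0 !witt_bracket0l scaler0.
elim/witt_ind: y => [b nu||x x' IH IH']; first last.
- by rewrite !witt_bracketDr [RHS]scalerDr; apply: (f_equal2 +%R IH IH').
- by rewrite !witt_bracket0r scaler0.
by rewrite witt_scaleU !witt_bracketUU witt_scaleU !mulrA.
Qed.

Fact witt_bracketC x y : witt_bracket x y = - witt_bracket y x.
Proof.
elim/witt_ind: x => [a mu||x x' IH IH']; first last.
- by rewrite witt_bracketDl witt_bracketDr opprD; apply: (f_equal2 +%R IH IH').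
- by rewrite witt_bracket0l witt_bracket0r oppr0.
elim/witt_ind: y => [b nu||x x' IH IH']; first last.
- by rewrite witt_bracketDl witt_bracketDr opprD; apply: (f_equal2 +%R IH IH').
- by rewrite witt_bracket0l witt_bracket0r oppr0.
rewrite !witt_bracketUU -monalgUN -mulrN opprB.
by rewrite [b * a]mulrC [mu + nu]addrC.
Qed.

Fact witt_bracketZr (c : k) x y :
  witt_bracket x (c *: y) = c *: witt_bracket x y.
Proof.
by rewrite witt_bracketC witt_bracketZl [in RHS]witt_bracketC scalerN.
Qed.

Fact witt_bracketxx x : witt_bracket x x = 0.
Proof.
elim/witt_ind: x => [a mu||x y Ex Ey].
- by rewrite witt_bracketUU subrr mulr0 monalgU0.
- exact: witt_bracket0l.
rewrite witt_bracketDl !witt_bracketDr Ex Ey add0r addr0.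
by rewrite [witt_bracket y x]witt_bracketC subrr.
Qed.

Fact witt_jacobi x y z :
  witt_bracket x (witt_bracket y z) + witt_bracket y (witt_bracket z x)
  + witt_bracket z (witt_bracket x y) = 0.
Proof.
have shuffle (a b c a' b' c' : W) : a + b + c = 0 -> a' + b' + c' = 0 ->
    (a + a') + (b + b') + (c + c') = 0.
  by move=> E E'; rewrite (addrACA a) (addrACA (a + b)) E E' addr0.
elim/witt_ind: x => [a mu||x x' IH IH']; first last.
- by rewrite !(witt_bracketDl, witt_bracketDr); apply: shuffle.
- by rewrite !(witt_bracket0l, witt_bracket0r) !addr0.
elim/witt_ind: y => [b nu||x x' IH IH']; first last.
- by rewrite !(witt_bracketDl, witt_bracketDr); apply: shuffle.
- by rewrite !(witt_bracket0l, witt_bracket0r) !addr0.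
elim/witt_ind: z => [c xi||x x' IH IH']; first last.
- by rewrite !(witt_bracketDl, witt_bracketDr); apply: shuffle.
- by rewrite !(witt_bracket0l, witt_bracket0r) !addr0.
rewrite !witt_bracketUU.
have -> : mu + xi + nu = xi + nu + mu by rewrite -addrA addrC.
have -> : nu + mu + xi = xi + nu + mu by rewrite addrC addrA.
have UD3 (u v w : k) g :
    (<< u *g g >> : W) + << v *g g >> + << w *g g >> = << u + v + w *g g >>.
  by rewrite !monalgUD.
rewrite UD3 -(monalgU0 (xi + nu + mu)); congr << _ *g _ >>.
by rewrite !raddfD /=; ring.
Qed.

HB.instance Definition _ := Lmodule_isLie.Build k W
  witt_bracketDl witt_bracketDr witt_bracketZl witt_bracketZr
  witt_bracketxx witt_jacobi.

Lemma lieb_witt_e mu nu :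
  lieb (witt_e mu) (witt_e nu) = (i nu - i mu) *: witt_e (nu + mu).
Proof. by rewrite [LHS]witt_bracketUU witt_scaleU !mulr1 mul1r. Qed.

End Witt.

Lemma mpoly_gen_ind (R : nzRingType) n (P : {mpoly R[n]} -> Prop) :
  (forall c, P (mpolyC n c)) -> (forall i, P 'X_i) ->
  (forall p q, P p -> P q -> P (p + q)) ->
  (forall p q, P p -> P q -> P (p * q)) -> forall p, P p.
Proof.
move=> PC PX PD PM p; rewrite [p]mpolyE.
elim/big_ind: _ => [||m _]; [by rewrite -(mpolyC0 n R) | exact: PD |].
rewrite -mul_mpolyC; apply: (PM) => //; rewrite mpolyXE_id.
elim/big_ind: _ => [||i _]; [by rewrite -(mpolyC1 n R) | exact: PM |].
elim: (m i) => [|e IHe]; first by rewrite expr0 -(mpolyC1 n R).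
by rewrite exprS; apply: PM.
Qed.

(* An additive group G acts through i : G -> k on k[a] = {poly k} by          *)
(* p(a) |-> p(a + i d), and on k[a, b] = {mpoly k[2]}, with a = 'X_0 and      *)
(* b = 'X_1, by p(a, b) |-> p(a + i d, b). Below, G is the subgroup Γ of k    *)
(* and i its inclusion.                                                       *)

Section Shifts.
Variables (k : fieldType) (G : zmodType) (i : {additive G -> k}).
Implicit Types d e : G.

Definition shift1 d (p : {poly k}) : {poly k} := p \Po ('X + (i d)%:P).

HB.instance Definition _ d :=
  GRing.LRMorphism.copy (shift1 d) (comp_poly ('X + (i d)%:P)).

Fact shift1_0 : shift1 0 =1 id.
Proof. by move=> p; rewrite /shift1 raddf0 addr0 comp_polyXr. Qed.

Fact shift1D d e : shift1 (d + e) =1 shift1 d \o shift1 e.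
Proof.
move=> p; rewrite /shift1 /= -comp_polyA comp_polyD comp_polyX comp_polyC.
by rewrite [i _]raddfD polyCD addrA.
Qed.

Definition shift1_act := AlgAction shift1_0 shift1D.

Definition va : {mpoly k[2]} := 'X_ord0.
Definition vb : {mpoly k[2]} := 'X_ord_max.

Definition shift2 d (p : {mpoly k[2]}) : {mpoly k[2]} :=
  p \mPo [tuple va + mpolyC 2 (i d); vb].

HB.instance Definition _ d := GRing.LRMorphism.copy (shift2 d)
  (comp_mpoly [tuple va + mpolyC 2 (i d); vb]).

Lemma shift2C d c : shift2 d (mpolyC 2 c) = mpolyC 2 c.
Proof. exact: comp_mpolyC. Qed.

Lemma shift2a d : shift2 d va = va + mpolyC 2 (i d).
Proof. by rewrite /shift2 comp_mpolyXU. Qed.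

Lemma shift2b d : shift2 d vb = vb.
Proof. by rewrite /shift2 comp_mpolyXU. Qed.

Lemma shift2Z d c p : shift2 d (c *: p) = c *: shift2 d p.
Proof. exact: comp_mpolyZ. Qed.

Lemma mpoly2_ind (P : {mpoly k[2]} -> Prop) :
  (forall c, P (mpolyC 2 c)) -> P va -> P vb ->
  (forall p q, P p -> P q -> P (p + q)) ->
  (forall p q, P p -> P q -> P (p * q)) -> forall p, P p.
Proof.
move=> PC Pa Pb; apply: mpoly_gen_ind => // j.
case: (unliftP ord_max j) => [j' ->|-> //].
by rewrite (_ : lift _ _ = ord0) //; apply/val_inj; case: j' => [[]].
Qed.

Fact shift2_0 : shift2 0 =1 id.
Proof.
elim/mpoly2_ind=> [c|||p q Ep Eq|p q Ep Eq] /=.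
- exact: shift2C.
- by rewrite shift2a raddf0 mpolyC0 addr0.
- exact: shift2b.
- by rewrite rmorphD /= Ep Eq.
- by rewrite rmorphM /= Ep Eq.
Qed.

Fact shift2D d e : shift2 (d + e) =1 shift2 d \o shift2 e.
Proof.
elim/mpoly2_ind=> [c|||p q Ep Eq|p q Ep Eq] /=.
- by rewrite !shift2C.
- by rewrite !shift2a rmorphD /= shift2a shift2C raddfD /= mpolyCD addrA.
- by rewrite !shift2b.
- by rewrite !rmorphD /= Ep Eq.
- by rewrite !rmorphM /= Ep Eq.
Qed.

Definition shift2_act := AlgAction shift2_0 shift2D.

End Shifts.

Arguments shift1_act {k G} i.
Arguments shift2_act {k G} i.
Arguments va {k}.
Arguments vb {k}.

(* phi : U(W_Γ) -> T is the anti-homomorphism induced by the universal        *)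
(* property of U(W_Γ) from e_mu |-> (a + b mu) t^mu; see phiM and phi_gen.    *)

Section ImageB.
Variables (k : fieldType) (G : zmodType) (i : {additive G -> k}).

Local Notation W := (witt i).
Local Notation U := (envelop W).
Local Notation T := (skew (shift2_act i)).
Local Notation S := (skew (shift1_act i)).

Definition phi_e (mu : G) : T := << va + i mu *: vb *g mu >>.

Fact image_key : unit. Proof. by []. Qed.

Definition phi_witt : W -> T := locked_with image_key (fun x =>
  \sum_(mu <- msupp x) x@_mu *: phi_e mu).

Let phik (mu : G) (c : k) : T := c *: phi_e mu.

Let phi_wittE x : phi_witt x = mext phik x.
Proof. by rewrite /phi_witt unlock. Qed.

Let phi_wittD : {morph phi_witt : x y / x + y}.
Proof.
by move=> x y; rewrite !phi_wittE; apply: mextD => mu c d; rewrite -scalerDl.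
Qed.

Lemma phi_wittU c mu : phi_witt << c *g mu >> = c *: phi_e mu.
Proof. by rewrite phi_wittE mextU // /phik scale0r. Qed.

Let phi_witt0 : phi_witt 0 = 0.
Proof. by rewrite phi_wittE mext0. Qed.

Lemma phi_wittZ (c : k) : {morph phi_witt : x / c *: x}.
Proof.
elim/witt_ind=> [d mu||x y Ex Ey].
- by rewrite witt_scaleU !phi_wittU -scalerA.
- by rewrite scaler0 phi_witt0 scaler0.
- by rewrite scalerDr !phi_wittD Ex Ey scalerDr.
Qed.

Lemma phi_eM mu nu :
  phi_e mu * phi_e nu
  = << (va + i mu *: vb) * (va + mpolyC 2 (i mu) + i nu *: vb) *g mu + nu >>.
Proof. by rewrite skewM /= rmorphD /= shift2Z shift2a shift2b. Qed.

Lemma phi_e_comm mu nu :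
  phi_e nu * phi_e mu - phi_e mu * phi_e nu
  = (i nu - i mu) *: phi_e (nu + mu).
Proof.
rewrite !phi_eM [mu + nu]addrC -monalgUB skewZ; congr << _ *g _ >>.
by rewrite [i (_ + _)]raddfD -!mul_mpolyC !mpolyCD mpolyCN; ring.
Qed.

Lemma phi_witt_lieb x y :
  phi_witt (lieb x y) = phi_witt y * phi_witt x - phi_witt x * phi_witt y.
Proof.
have addl (a b c d : T) : a - b + (c - d) = a + c - (b + d).
  by rewrite opprD addrACA.
elim/witt_ind: x => [c mu||x x' IH IH']; first last.
- rewrite liebDl !phi_wittD mulrDl mulrDr -addl.
  exact: (f_equal2 +%R IH IH').
- by rewrite [lieb _ _]witt_bracket0l phi_witt0 mul0r mulr0 subr0.
elim/witt_ind: y => [d nu||x x' IH IH']; first last.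
- rewrite liebDr !phi_wittD mulrDl mulrDr -addl.
  exact: (f_equal2 +%R IH IH').
- by rewrite [lieb _ _]witt_bracket0r phi_witt0 mul0r mulr0 subr0.
rewrite [lieb _ _]witt_bracketUU !phi_wittU -[LHS]scalerA -phi_e_comm.
move: (phi_e mu) (phi_e nu) => f g.
by rewrite -!scalerAl -!scalerAr !scalerA [d * c]mulrC -scalerBr.
Qed.

Lemma phi_witt_lie : lie_morphism (phi_witt : W -> T^c).
Proof. by split; [exact: phi_wittD|exact: phi_wittZ|exact: phi_witt_lieb]. Qed.

Definition phi (u : U) : T := ulift (phi_witt : W -> T^c) u.

Lemma phiD : {morph phi : u v / u + v}.
Proof. exact: (uliftD phi_witt_lie). Qed.

Lemma phiZ (c : k) : {morph phi : u / c *: u}.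
Proof. exact: (uliftZ phi_witt_lie). Qed.

Lemma phi1 : phi 1 = 1.
Proof. exact: (ulift1 phi_witt_lie). Qed.

Lemma phiM u v : phi (u * v) = phi v * phi u.
Proof. exact: (uliftM phi_witt_lie). Qed.

Lemma phi_gen mu : phi (ugen (witt_e i mu)) = phi_e mu.
Proof. by rewrite [LHS](ulift_gen phi_witt_lie) phi_wittU scale1r. Qed.

Section Specialize.
Variable beta : k.

Definition ev (p : {mpoly k[2]}) : {poly k} :=
  mpoly.mmap polyC (fun i => if i == ord0 then 'X else beta%:P) p.

HB.instance Definition _ := GRing.RMorphism.copy ev
  (mpoly.mmap polyC (fun i => if i == ord0 then 'X else beta%:P)).

Lemma evC c : ev (mpolyC 2 c) = c%:P.
Proof. exact: mpoly.mmapC. Qed.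

Lemma eva : ev va = 'X.
Proof. by rewrite /ev mmapX mmap1U. Qed.

Lemma evb : ev vb = beta%:P.
Proof. by rewrite /ev mmapX mmap1U. Qed.

Lemma ev_shift d p : ev (shift2 i d p) = shift1 i d (ev p).
Proof.
elim/mpoly2_ind: p => [c|||p q Ep Eq|p q Ep Eq].
- by rewrite shift2C evC /shift1 comp_polyC.
- by rewrite shift2a rmorphD /= eva evC /shift1 comp_polyX.
- by rewrite shift2b evb /shift1 comp_polyC.
- by rewrite !rmorphD /= Ep Eq.
- by rewrite !rmorphM /= Ep Eq.
Qed.

(* The quotient map T -> T/(b - beta)T, identified with k[a] ⋊ Γ: it sets b   *)
(* to beta; see specM, spec_surj and spec_ker.                                *)
Definition spec : T -> S := locked_with image_key (fun f =>
  \sum_(d <- msupp f) << ev f@_d *g d >>).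

Let speck (d : G) (p : {mpoly k[2]}) : S := << ev p *g d >>.

Let specE f : spec f = mext speck f.
Proof. by rewrite /spec unlock. Qed.

Lemma specU p d : spec << p *g d >> = << ev p *g d >>.
Proof. by rewrite specE mextU // /speck rmorph0 monalgU0. Qed.

Lemma spec0 : spec 0 = 0.
Proof. by rewrite specE mext0. Qed.

Lemma specD : {morph spec : f g / f + g}.
Proof.
move=> f g; rewrite !specE; apply: mextD => d p q.
by rewrite /speck rmorphD monalgUD.
Qed.

Lemma specN : {morph spec : f / - f}.
Proof. by move=> f; apply: (addrI (spec f)); rewrite -specD !subrr spec0. Qed.

Lemma spec1 : spec 1 = 1.
Proof. by rewrite [LHS]specU rmorph1. Qed.

Lemma specZ (c : k) : {morph spec : f / c *: f}.
Proof.
elim/skew_ind=> [p d||f g Ef Eg].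
- by rewrite skewZ !specU skewZ -mul_mpolyC rmorphM /= evC mul_polyC.
- by rewrite scaler0 spec0 scaler0.
- by rewrite scalerDr !specD Ef Eg scalerDr.
Qed.

Lemma specM : {morph spec : f g / f * g}.
Proof.
move=> f g; elim/skew_ind: f => [p d||f f' IH IH']; first last.
- by rewrite mulrDl !specD IH IH' mulrDl.
- by rewrite mul0r spec0 mul0r.
elim/skew_ind: g => [q e||f f' IH IH']; first last.
- by rewrite mulrDr !specD IH IH' mulrDr.
- by rewrite mulr0 spec0 mulr0.
by rewrite skewM !specU skewM rmorphM /= ev_shift.
Qed.

Lemma ev_split p :
  exists q, p = (map_poly (@mpolyC 2 k) (ev p)).[va] + (vb - mpolyC 2 beta) * q.
Proof.
elim/mpoly2_ind: p => [c|||p q [p' Ep] [q' Eq]|p q [p' Ep] [q' Eq]].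
- by exists 0; rewrite evC map_polyC /= hornerC mulr0 addr0.
- by exists 0; rewrite eva map_polyX hornerX mulr0 addr0.
- by exists 1; rewrite evb map_polyC /= hornerC mulr1 addrC subrK.
- exists (p' + q'); rewrite !rmorphD /= hornerD {1}Ep {1}Eq.
  by rewrite mulrDr addrACA.
set A := (map_poly _ (ev p)).[va] in Ep *.
set A' := (map_poly _ (ev q)).[va] in Eq *.
exists (p' * q + A * q').
rewrite (_ : _.[va] = A * A'); last by rewrite !rmorphM /= hornerM.
by clearbody A A'; rewrite Ep Eq; ring.
Qed.

Lemma ev_ker p : ev p = 0 -> exists q, p = (vb - mpolyC 2 beta) * q.
Proof.
move=> p0; have [q ->] := ev_split p.
by exists q; rewrite p0 rmorph0 horner0 add0r.
Qed.

Lemma ev_surj r : exists p, ev p = r.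
Proof.
elim/poly_ind: r => [|r c [p <-]]; first by exists 0; rewrite rmorph0.
by exists (p * va + mpolyC 2 c); rewrite rmorphD rmorphM /= eva evC.
Qed.

Lemma spec_surj (g : S) : exists f, spec f = g.
Proof.
elim/skew_ind: g => [r d||_ _ [f <-] [g <-]].
- by have [p <-] := ev_surj r; exists << p *g d >>; rewrite specU.
- by exists 0; rewrite spec0.
- by exists (f + g); rewrite specD.
Qed.

Lemma mcoeff_spec (f : T) d : (spec f)@_d = ev f@_d.
Proof.
elim/skew_ind: f => [p e||f g Ef Eg].
- by rewrite specU !mcoeffU rmorphMn.
- by rewrite spec0 !mcoeff0 rmorph0.
- by rewrite specD !mcoeffD Ef Eg rmorphD.
Qed.

(* The kernel of spec is the ideal (b - beta)T generated by the central       *)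
(* element b - beta.                                                          *)
Lemma spec_ker (f : T) :
  spec f = 0 <-> exists g, f = (<< vb - mpolyC 2 beta *g 0 >> : T) * g.
Proof.
split=> [f0|[g ->]]; last first.
  by rewrite specM specU rmorphB /= evb evC subrr monalgU0 mul0r.
have fd d : exists q, f@_d = (vb - mpolyC 2 beta) * q.
  by apply: ev_ker; rewrite -mcoeff_spec f0 mcoeff0.
rewrite [f]monalgE; elim/big_ind: _ => [|_ _ [g ->] [h ->]|d _].
- by exists 0; rewrite mulr0.
- by exists (g + h); rewrite mulrDr.
have [q ->] := fd d; exists << q *g d >>.
by rewrite skewM act0 add0r.
Qed.

Definition Bbeta_pred : {pred S} :=
  fun x => `[< exists u : U, spec (phi u) = x >].

Fact Bbeta_subring : subring_closed Bbeta_pred.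
Proof.
split=> [|_ _ /asboolP[u <-] /asboolP[v <-]|_ _ /asboolP[u <-] /asboolP[v <-]].
- by apply/asboolP; exists 1; rewrite phi1 spec1.
- apply/asboolP; exists (u + (-1) *: v).
  by rewrite phiD phiZ specD specZ scaleN1r.
- by apply/asboolP; exists (v * u); rewrite phiM specM.
Qed.

HB.instance Definition _ :=
  GRing.isSubringClosed.Build S Bbeta_pred Bbeta_subring.

Definition Bbeta : Type := {x : S | x \in Bbeta_pred}.

HB.instance Definition _ := SubType.on Bbeta.
HB.instance Definition _ := Choice.on Bbeta.
HB.instance Definition _ := [SubChoice_isSubNzRing of Bbeta by <:].

End Specialize.

End ImageB.

Section Noetherian.
Variable R : nzRingType.

Definition left_ideal (I : R -> Prop) : Prop :=
  [/\ I 0, forall x y, I x -> I y -> I (x + y) & forall a x, I x -> I (a * x)].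

Definition right_ideal (I : R -> Prop) : Prop :=
  [/\ I 0, forall x y, I x -> I y -> I (x + y) & forall a x, I x -> I (x * a)].

Definition acc (P : (R -> Prop) -> Prop) : Prop :=
  forall I : nat -> R -> Prop, (forall n, P (I n)) ->
  (forall n x, I n x -> I n.+1 x) ->
  exists N, forall n, (N <= n)%N -> forall x, I n x <-> I N x.

Definition left_noetherian : Prop := acc left_ideal.
Definition right_noetherian : Prop := acc right_ideal.

End Noetherian.

(* Main.v *)
Require Import Defs.
(* Write S = k[a] ⋊ Γ and x_mu = (a + beta mu) t^mu.  A skew version of the   *)
(* Hilbert basis theorem, adjoining to k first a and then t^{±s} for s in a   *)
(* generating set of Γ, shows that S is right noetherian; the anti-involution *)
(* of S that fixes a and sends t^mu to t^{-mu} makes it left noetherian.      *)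
(*   If beta is neither 0 nor 1, then t^mu is proportional to                 *)
(* x_{2mu} x_{-mu} - (a + 2mu) x_mu, so B_beta = S.  The anti-involution      *)
(* exchanges B_beta and B_{1 - beta}, which leaves B_0 = k + aS, the          *)
(* idealizer of the right ideal aS.  As in Robson's theory of idealizers, a   *)
(* chain of right ideals J_n of B_0 is controlled by the right ideals J_n S   *)
(* and J_n aS of S, and a chain of left ideals by the left ideals S J_n and   *)
(* S K_n, where K_n = {u | a u in J_n}: the eigenvectors t^mu of a have       *)
(* distinct eigenvalues modulo aS, so J_n can be cut out by polynomials in a. *)
From HB Require Import structures.
From mathcomp Require Import all_boot all_order all_algebra.
From mathcomp Require Import boolp ring.
From mathcomp.multinomials Require Import monalg.
From mathcomp.multinomials Require mpoly.

Set Implicit Arguments.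
Unset Strict Implicit.
Unset Printing Implicit Defensive.

Import GRing.Theory.

Local Open Scope ring_scope.

(** S is noetherian because each element adjoined in [noetherian_tower] normalises the subring built
    before it, so that [hilbert_basis] applies. For beta outside {0, 1}, B_beta is all of S
    ([Bbeta_full]). For beta = 0, the ring B = k + aS contains the right ideal aS of S. Hence, for a
    right ideal J of B, J aS is a right ideal of S contained in J. If p(0) = 1, then y = y p(a) + y
    (1 - p(a)) with 1 - p(a) in aS; for y in JS some such p puts y p(a) in J ([right_span_project]).
    So nested right ideals of B with the same JS and the same J aS coincide ([acc_right_idealizer]);
    the left side is analogous ([acc_left_idealizer]). For beta = 1, [tflip] carries each one-sided
    condition on B_0 to the opposite one on B_1. *)

Section IdealsIn.
Variable A : nzRingType.
Implicit Types (B : {pred A}) (J : A -> Prop).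

(** Everything lives in the ambient ring [A], so ideals of different subrings can be compared
    without subtypes; [predT] gives the ideals of [A] itself. *)
Definition left_ideal_in B J : Prop :=
  [/\ forall x, J x -> x \in B, J 0, forall x y, J x -> J y -> J (x + y)
    & forall b x, b \in B -> J x -> J (b * x)].

Definition right_ideal_in B J : Prop :=
  [/\ forall x, J x -> x \in B, J 0, forall x y, J x -> J y -> J (x + y)
    & forall b x, b \in B -> J x -> J (x * b)].

Lemma chain_le (I : nat -> A -> Prop) :
  (forall n x, I n x -> I n.+1 x) ->
  forall m n, (m <= n)%N -> forall x, I m x -> I n x.
Proof.
by move=> IS m n /subnK <- x; elim: (n - m)%N => // j IHj /IHj; apply: IS.
Qed.

Section AntiInvolution.
Variables (s : A -> A) (B B' : {pred A}).
Hypotheses (sK : involutive s) (sD : {morph s : x y / x + y})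
  (sM : forall x y, s (x * y) = s y * s x)
  (sB : forall x, (s x \in B) = (x \in B')).

Let s0 : s 0 = 0.
Proof. by apply: (addrI (s 0)); rewrite -sD !addr0. Qed.

Let sB' x : (s x \in B') = (x \in B).
Proof. by rewrite -sB sK. Qed.

Lemma acc_right_anti : acc (left_ideal_in B) -> acc (right_ideal_in B').
Proof.
move=> accB J idJ JS; have [|n x /JS //|N HN] := accB (fun n x => J n (s x)).
  move=> n; have [JB J0 JD JM] := idJ n; split=> [x /JB|||b x Bb Jx].
  - by rewrite sB'.
  - by rewrite s0.
  - by move=> x y Jx Jy; rewrite sD; apply: JD.
  - by rewrite sM; apply: JM; rewrite ?sB'.
by exists N => n le_Nn x; have := HN n le_Nn (s x); rewrite sK.
Qed.

Lemma acc_left_anti : acc (right_ideal_in B) -> acc (left_ideal_in B').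
Proof.
move=> accB J idJ JS; have [|n x /JS //|N HN] := accB (fun n x => J n (s x)).
  move=> n; have [JB J0 JD JM] := idJ n; split=> [x /JB|||b x Bb Jx].
  - by rewrite sB'.
  - by rewrite s0.
  - by move=> x y Jx Jy; rewrite sD; apply: JD.
  - by rewrite sM; apply: JM; rewrite ?sB'.
by exists N => n le_Nn x; have := HN n le_Nn (s x); rewrite sK.
Qed.

End AntiInvolution.
End IdealsIn.

(** * The skew Hilbert basis theorem *)

Section HilbertBasis.
Variable A : nzRingType.

(** [x] may satisfy relations over [R], so an element can have several representing polynomials. *)
Definition poly_ext (R : {pred A}) (x : A) : {pred A} :=
  fun f => `[< exists2 p, p \is a polyOver R & f = p.[x] >].

Lemma poly_extP (R : {pred A}) x f :
  reflect (exists2 p, p \is a polyOver R & f = p.[x]) (f \in poly_ext R x).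
Proof. exact: asboolP. Qed.

Variables (R : subringClosed A) (x : A).

Lemma poly_ext_sub r : r \in R -> r \in poly_ext R x.
Proof. by move=> Rr; apply/poly_extP; exists r%:P; rewrite ?polyOverC ?hornerC. Qed.

Lemma poly_ext_gen : x \in poly_ext R x.
Proof. by apply/poly_extP; exists 'X; rewrite ?polyOverX ?hornerX. Qed.

Lemma poly_ext_zmod : zmod_closed (poly_ext R x).
Proof.
split=> [|_ _ /poly_extP[p Rp ->] /poly_extP[q Rq ->]].
  exact/poly_ext_sub/rpred0.
by apply/poly_extP; exists (p - q); rewrite ?rpredB // hornerD hornerN.
Qed.

(** The relation moves coefficients to the left of powers of [x]. It is opposite to the one in
    [hilbert_basis]: for [x = tpow e] the two twists are [tconj e] and [tconj (- e)]. *)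
Lemma poly_ext_subring (th : A -> A) :
  (forall r, r \in R -> th r \in R) ->
  (forall r, r \in R -> x * r = th r * x) -> subring_closed (poly_ext R x).
Proof.
move=> thR xth.
pose E := HB.pack_for (zmodClosed A) (poly_ext R x)
  (GRing.isZmodClosed.Build A (poly_ext R x) poly_ext_zmod).
have xnth n r : r \in R -> exists2 r', r' \in R & x ^+ n * r = r' * x ^+ n.
  elim: n r => [|n IHn] r Rr; first by exists r; rewrite ?mulr1 ?mul1r.
  have [r' Rr' Er] := IHn _ (thR r Rr); exists r' => //.
  by rewrite exprSr -mulrA xth // mulrA Er mulrA.
have [_ B] := poly_ext_zmod; split=> //; first exact/poly_ext_sub/rpred1.
move=> _ _ /poly_extP[p Rp ->] /poly_extP[q Rq ->].
rewrite !horner_coef mulr_suml; apply: (rpred_sum (S := E)) => i _.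
rewrite mulr_sumr; apply: (rpred_sum (S := E)) => j _.
have [|r' Rr' Er] := xnth i q`_j; first exact: (polyOverP Rq).
rewrite mulrA -[_ * _ * q`_j]mulrA Er -!mulrA -exprD mulrA.
apply/poly_extP; exists ((p`_i * r') *: 'X^(i + j)); last by rewrite hornerZ hornerXn.
by rewrite polyOverZ ?polyOverXn // rpredM // (polyOverP Rp).
Qed.

(* The coefficients stand on the left of the powers of x, so the hypothesis   *)
(* r x = x (th r) is what makes the leading coefficients of degree d of a     *)
(* right ideal a right ideal of R.                                            *)
Lemma hilbert_basis (th : A -> A) :
  (forall r, r \in R -> th r \in R) ->
  (forall r, r \in R -> r * x = x * th r) ->
  acc (right_ideal_in R) -> acc (right_ideal_in (poly_ext R x)).
Proof.
move=> thR xth accR J idJ JS; have Jle := chain_le JS.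
pose L d n r := exists p,
  [/\ p \is a polyOver R, (size p <= d.+1)%N, J n p.[x] & p`_d = r].
have L_id d n : right_ideal_in R (L d n).
  have [JB J0 JD JM] := idJ n.
  split=> [_ [p [Rp _ _ <-]]|||b _ Rb [p [Rp szp Jp <-]]].
  - exact: (polyOverP Rp).
  - by exists 0; rewrite rpred0 size_poly0 horner0 coef0.
  - move=> _ _ [p [Rp szp Jp <-]] [q [Rq szq Jq <-]].
    exists (p + q); rewrite rpredD // hornerD coefD; split=> //.
      by rewrite (leq_trans (size_polyD _ _)) // geq_max szp.
    exact: JD.
  have thR' m r : r \in R -> iter m th r \in R.
    by move=> Rr; elim: m => //= m; apply: thR.
  have comm i m r : r \in R -> x ^+ i * iter (i + m) th r = iter m th r * x ^+ i.
    move=> Rr; elim: i => [|i IHi]; first by rewrite mul1r mulr1.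
    by rewrite addSn /= exprSr -mulrA -xth ?thR' // [LHS]mulrA IHi mulrA.
  (* This polynomial represents [p.[x] * iter d th b]: moving the twisted factor left past [x ^+ i]
     removes [i] twists, which leaves exactly [b] at the top degree. *)
  exists (\poly_(i < d.+1) (p`_i * iter (d - i) th b)); split.
  - by apply/polyOver_poly => i _; rewrite rpredM ?thR' ?(polyOverP Rp).
  - exact: size_poly.
  - have -> : (\poly_(i < d.+1) (p`_i * iter (d - i) th b)).[x]
              = p.[x] * iter d th b.
      rewrite horner_poly (horner_coef_wide _ szp) mulr_suml.
      apply: eq_bigr => i _; rewrite -!mulrA -comm //.
      by rewrite subnKC // -ltnS.
    by apply: JM => //; apply/poly_ext_sub/thR'.
  - by rewrite coef_poly ltnSn subnn.
have LSd d n r : L d n r -> L d.+1 n r.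
  have [_ _ _ JM] := idJ n; case=> p [Rp szp Jp <-]; exists (p * 'X).
  rewrite rpredM ?polyOverX // hornerMX coefMX; split=> //.
    by rewrite (leq_trans (size_polyMleq _ _)) // size_polyX addn2.
  by apply: JM Jp; apply: poly_ext_gen.
have LSn d n r : L d n r -> L d n.+1 r.
  by case=> p [Rp szp /JS Jp <-]; exists p.
have Ld n : forall d e, (d <= e)%N -> forall r, L d n r -> L e n r.
  by apply: (chain_le (I := fun d => L d n)) => d r; apply: LSd.
have Ln d : forall m n, (m <= n)%N -> forall r, L d m r -> L d n r.
  by apply: (chain_le (I := L d)) => n r; apply: LSn.
(* The diagonal chain settles all degrees [d >= N] at once; the finitely many lower degrees are
   settled one by one by [M]. *)
have [|n r /LSd /LSn //|N HN] := accR (fun n => L n n); first by move=> n; exact: L_id.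
have [M HM] : exists M, forall d, (d < N)%N -> forall n r, L d n r -> L d M r.
  elim: (N) => [|N' [M HM]]; first by exists 0%N.
  have [M' HM'] := accR _ (L_id N') (LSn N').
  exists (maxn M M') => d; rewrite ltnS leq_eqVlt => /predU1P[->|lt_dN'] n r Lr.
    apply: (Ln _ _ _ (leq_maxr M M')).
    apply/(HM' _ (leq_maxr n M')); exact: Ln (leq_maxl _ _) _ Lr.
  exact: Ln (leq_maxl _ _) _ (HM _ lt_dN' _ _ Lr).
have stable d n r : L d n r -> L d (maxn M N) r.
  have [lt_dN Lr|le_Nd Lr] := ltnP d N.
    exact: Ln (leq_maxl _ _) _ (HM _ lt_dN _ _ Lr).
  apply: (Ln _ _ _ (leq_maxr _ _)); apply: (Ld _ _ _ le_Nd).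
  apply/(HN (maxn d n)); first by rewrite leq_max le_Nd.
  by apply: (Ld _ _ _ (leq_maxl _ _)); apply: Ln (leq_maxr _ _) _ Lr.
exists (maxn M N) => n le_n f; split; last exact: Jle.
move=> Jf; have [JB _ _ _] := idJ n; have /poly_extP[p Rp Ef] := JB _ Jf.
rewrite {}Ef in Jf *; have [m] := ubnPleq (size p).
elim: m p Rp Jf => [|m IHm] p Rp Jp szp.
  have [_ J0 _ _] := idJ (maxn M N).
  by move: szp; rewrite leqn0 size_poly_eq0 => /eqP->; rewrite horner0.
(* Subtracting [q] cancels the coefficient of degree [m], so induction on the size applies to
   [p - q]. *)
have [q [Rq szq Jq Eq]] : L m (maxn M N) p`_m by apply: (stable _ n); exists p.
have JN j y : J j y -> J j (- y).
  have [_ _ _ JM] := idJ j.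
  by move=> Jy; rewrite -mulrN1; apply: JM Jy; apply/poly_ext_sub/rpredN1.
have [_ _ JD _] := idJ n; have [_ _ JD' _] := idJ (maxn M N).
rewrite -(subrK q p) hornerD; apply: (JD') => //; apply: IHm.
- by rewrite rpredB.
- rewrite hornerD hornerN; apply: JD => //; apply: JN.
  exact: Jle Jq.
apply/leq_sizeP => j; rewrite leq_eqVlt => /predU1P[<-|lt_mj].
  by rewrite coefB Eq subrr.
by rewrite coefB !nth_default ?subrr // (leq_trans _ lt_mj).
Qed.

End HilbertBasis.

Lemma acc_right_scalars (F : fieldType) (A : algType F) (R : {pred A}) :
  (forall f, f \in R <-> exists c : F, f = c%:A) -> acc (right_ideal_in R).
Proof.
move=> RP J idJ JS.
have [[n [x [Jx nz_x]]]|J0] := pselect (exists n x, J n x /\ x != 0).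
  exists n => m le_nm y; split; last exact: (chain_le JS).
  have [JR _ _ JM] := idJ n; have [JR' _ _ _] := idJ m.
  have [c Ex] := (RP x).1 (JR _ Jx); move=> /JR'/RP[d ->].
  have nz_c : c != 0 by apply: contraNneq nz_x => c0; rewrite Ex c0 scale0r.
  have -> : d%:A = x * (c^-1 * d)%:A.
    by rewrite Ex -scalerAl mul1r scalerA mulVKf.
  by apply: JM => //; apply/RP; eexists.
have J0P n x : J n x -> x = 0.
  by move=> Jx; apply: contrapT => /eqP nz_x; apply: J0; exists n, x.
by exists 0%N => n _ x; split=> /J0P->; [case: (idJ 0%N) | case: (idJ n)].
Qed.

(** * One-sided ideals generated by a subset *)

Section Spans.
Variable A : nzRingType.
Implicit Types J : A -> Prop.

Inductive right_span J : A -> Prop :=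
| right_span0 : right_span J 0
| right_spanD x s y : J x -> right_span J y -> right_span J (x * s + y).

Inductive left_span J : A -> Prop :=
| left_span0 : left_span J 0
| left_spanD x s y : J x -> left_span J y -> left_span J (s * x + y).

Lemma right_span_sub J x : J x -> right_span J x.
Proof. by move=> Jx; rewrite -[x]addr0 -{1}[x]mulr1; apply/right_spanD/right_span0. Qed.

Lemma left_span_sub J x : J x -> left_span J x.
Proof. by move=> Jx; rewrite -[x]addr0 -{1}[x]mul1r; apply/left_spanD/left_span0. Qed.

Lemma right_span_ideal J : right_ideal_in predT (right_span J).
Proof.
split=> //; first exact: right_span0.
- move=> x y Jx Jy; elim: Jx => [|z s w Jz _ IH]; first by rewrite add0r.
  by rewrite -addrA; apply: right_spanD.
- move=> b x _; elim=> [|z s w Jz _ IH]; first by rewrite mul0r; apply: right_span0.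
  by rewrite mulrDl -mulrA; apply: right_spanD.
Qed.

Lemma left_span_ideal J : left_ideal_in predT (left_span J).
Proof.
split=> //; first exact: left_span0.
- move=> x y Jx Jy; elim: Jx => [|z s w Jz _ IH]; first by rewrite add0r.
  by rewrite -addrA; apply: left_spanD.
- move=> b x _; elim=> [|z s w Jz _ IH]; first by rewrite mulr0; apply: left_span0.
  by rewrite mulrDr mulrA; apply: left_spanD.
Qed.

Lemma right_spanS J J' : (forall x, J x -> J' x) ->
  forall x, right_span J x -> right_span J' x.
Proof.
move=> sJ x; elim=> [|z s w /sJ Jz _ IH]; first exact: right_span0.
exact: right_spanD.
Qed.

Lemma left_spanS J J' : (forall x, J x -> J' x) ->
  forall x, left_span J x -> left_span J' x.
Proof.
move=> sJ x; elim=> [|z s w /sJ Jz _ IH]; first exact: left_span0.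
exact: left_spanD.
Qed.

End Spans.

(** * The ring k[a] ⋊ Γ *)

Section SkewLaurent.
Variables (k : fieldType) (G : zmodType) (i : {additive G -> k}).

Local Notation S := (Defs.skew (shift1_act i)).

Definition spoly (p : {poly k}) : S := << p *g 0 >>.
Definition tpow (d : G) : S := << 1 *g d >>.

Lemma act_shift1 d p : shift1_act i d p = shift1 i d p.
Proof. by []. Qed.

Lemma shift1K d : cancel (shift1 i (- d)) (shift1 i d).
Proof. by move=> p; rewrite -[LHS]shift1D subrr shift1_0. Qed.

Lemma shift1X d : shift1 i d 'X = 'X + (i d)%:P.
Proof. exact: comp_polyX. Qed.

Lemma shift1C d c : shift1 i d c%:P = c%:P.
Proof. exact: comp_polyC. Qed.

Lemma spolyM p q : spoly (p * q) = spoly p * spoly q.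
Proof. by rewrite /spoly skewM addr0 act0. Qed.

Lemma spolyD p q : spoly (p + q) = spoly p + spoly q.
Proof. exact: monalgUD. Qed.

Lemma spoly1 : spoly 1 = 1.
Proof. by []. Qed.

Lemma spolyC c : spoly c%:P = c%:A.
Proof. by rewrite [RHS]skewZ alg_polyC. Qed.

Lemma tpowD d e : tpow (d + e) = tpow d * tpow e.
Proof. by rewrite [RHS]skewM rmorph1 mulr1. Qed.

Lemma skewE p d : << p *g d >> = spoly p * tpow d.
Proof. by rewrite skewM rmorph1 mulr1 add0r. Qed.

Definition tconj d (f : S) : S := tpow d * f * tpow (- d).

Lemma tconjM d f g : tconj d (f * g) = tconj d f * tconj d g.
Proof.
rewrite /tconj !mulrA; congr (_ * _ * _).
by rewrite -[_ * tpow (- d) * _]mulrA -tpowD addNr mulr1.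
Qed.

Lemma tconj1 d : tconj d 1 = 1.
Proof. by rewrite /tconj mulr1 -tpowD subrr. Qed.

Lemma tconjX d f n : tconj d (f ^+ n) = tconj d f ^+ n.
Proof. by elim: n => [|n IHn]; rewrite ?tconj1 // !exprS tconjM IHn. Qed.

Lemma tconj_sum d n (F : 'I_n -> S) :
  tconj d (\sum_j F j) = \sum_j tconj d (F j).
Proof. by rewrite /tconj mulr_sumr mulr_suml. Qed.

Lemma tconj_scalar d c : tconj d c%:A = c%:A.
Proof. by rewrite /tconj -scalerAr -scalerAl mulr1 -tpowD subrr. Qed.

Lemma tconj_spoly d p : tconj d (spoly p) = spoly (shift1 i d p).
Proof. by rewrite /tconj !skewM !rmorph1 mulr1 mul1r addr0 subrr. Qed.

Lemma tmulr_tpow d e : tconj d (tpow e) = tpow e.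
Proof. by rewrite /tconj -!tpowD addrAC subrr add0r. Qed.

Lemma mull_tpow d f : tpow d * f = tconj d f * tpow d.
Proof. by rewrite /tconj -!mulrA -tpowD addNr mulr1. Qed.

Lemma mulr_tpow d f : f * tpow d = tpow d * tconj (- d) f.
Proof. by rewrite /tconj opprK !mulrA -tpowD subrr mul1r. Qed.

(** The invariant of the tower: it makes the next [tpow e] normalise [R]. *)
Definition tstable (R : {pred S}) : Prop :=
  forall d f, f \in R -> tconj d f \in R.

Lemma tstable_poly_ext (R : subringClosed S) x : subring_closed (poly_ext R x) ->
  tstable R -> (forall d, tconj d x \in poly_ext R x) -> tstable (poly_ext R x).
Proof.
move=> subE stR stx d _ /poly_extP[p Rp ->].
pose E := HB.pack_for (subringClosed S) (poly_ext R x)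
  (GRing.isSubringClosed.Build S (poly_ext R x) subE).
rewrite horner_coef tconj_sum; apply: (rpred_sum (S := E)) => j _.
rewrite tconjM tconjX; apply: (@rpredM _ E); last exact: (@rpredX _ E).
exact/poly_ext_sub/stR/(polyOverP Rp).
Qed.

Definition scalars : {pred S} := fun f => `[< exists c : k, f = c%:A >].

Lemma scalarsP f : f \in scalars <-> exists c : k, f = c%:A.
Proof. exact: iff_sym (rwP (asboolP _)). Qed.

Lemma scalars_subring : subring_closed scalars.
Proof.
split=> [|_ _ /scalarsP[c ->] /scalarsP[d ->]|_ _ /scalarsP[c ->] /scalarsP[d ->]].
- by apply/scalarsP; exists 1; rewrite scale1r.
- by apply/scalarsP; exists (c - d); rewrite scalerBl.
- by apply/scalarsP; exists (c * d); rewrite -scalerAl mul1r scalerA.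
Qed.

(* S is obtained from k by adjoining first a, then t^e for finitely many e;   *)
(* each step normalises the subring built so far.                             *)
Lemma noetherian_tower (l : seq G) : exists R : subringClosed S,
  [/\ tstable R, acc (right_ideal_in R), forall p, spoly p \in R
    & forall e, e \in l -> tpow e \in R].
Proof.
elim: l => [|e l [R [stR accR spR tR]]].
  pose R := HB.pack_for (subringClosed S) scalars
    (GRing.isSubringClosed.Build S scalars scalars_subring).
  have comm r : r \in R -> r * spoly 'X = spoly 'X * r.
    by move/scalarsP=> [c ->]; rewrite -scalerAl -scalerAr mulr1 mul1r.
  have subE := @poly_ext_subring S R (spoly 'X) id (fun r Rr => Rr)
    (fun r Rr => esym (comm r Rr)).
  pose E := HB.pack_for (subringClosed S) (poly_ext R (spoly 'X))
    (GRing.isSubringClosed.Build S (poly_ext R (spoly 'X)) subE).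
  have RC c : spoly c%:P \in E.
    by apply/poly_ext_sub/scalarsP; exists c; rewrite spolyC.
  exists E; split=> //.
  - apply: tstable_poly_ext => // [d f /scalarsP[c ->]|d].
      by rewrite tconj_scalar; apply/scalarsP; exists c.
    rewrite tconj_spoly shift1X spolyD; apply: (rpredD (S := E)); last exact: RC.
    exact: poly_ext_gen.
  - apply: (@hilbert_basis S R _ id) => //.
    exact/acc_right_scalars/scalarsP.
  - elim/poly_ind=> [|p c Ep]; first exact: (RC 0).
    by rewrite spolyD spolyM rpredD ?RC // rpredM // poly_ext_gen.
have subE := @poly_ext_subring S R (tpow e) _ (stR e) (fun r _ => mull_tpow e r).
pose E := HB.pack_for (subringClosed S) (poly_ext R (tpow e))
  (GRing.isSubringClosed.Build S (poly_ext R (tpow e)) subE).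
exists E; split=> [||p|d].
- apply: tstable_poly_ext => // d; rewrite tmulr_tpow; exact: poly_ext_gen.
- exact: hilbert_basis (stR (- e)) (fun r _ => mulr_tpow e r) accR.
- exact/poly_ext_sub/spR.
- rewrite inE => /predU1P[->|/tR Rd]; first exact: poly_ext_gen.
  exact: poly_ext_sub.
Qed.

(** Generation as a monoid, since [poly_ext] adjoins only nonnegative powers of [tpow e]. *)
Definition monoid_generates (l : seq G) : Prop := forall P : G -> Prop,
  P 0 -> (forall d e, d \in l -> P e -> P (d + e)) -> forall d, P d.

Lemma acc_right_skew l :
  monoid_generates l -> acc (right_ideal_in (predT : {pred S})).
Proof.
move=> gen_l; have [R [_ accR spR tR]] := noetherian_tower l.
have RT f : f \in R.
  elim/skew_ind: f => [p d||f g Rf Rg]; rewrite ?rpred0 ?rpredD //.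
  rewrite skewE rpredM //; elim/gen_l: d => [|d e /tR Rd Re].
    exact: rpred1.
  by rewrite tpowD rpredM.
move=> J idJ; apply: accR => n; have [_ J0 JD JM] := idJ n.
by split=> // b x _; apply: JM.
Qed.

(** The image of p t^d is t^{-d} p, rewritten with its coefficient on the left. *)
Definition tflip (f : S) : S :=
  mext (fun d p => << shift1 i (- d) p *g - d >> : S) f.

Lemma tflipU p d : tflip << p *g d >> = << shift1 i (- d) p *g - d >>.
Proof. by rewrite /tflip mextU // rmorph0 monalgU0. Qed.

Lemma tflipD : {morph tflip : f g / f + g}.
Proof. by apply: mextD => d p q; rewrite rmorphD monalgUD. Qed.

Lemma tflip0 : tflip 0 = 0.
Proof. exact: mext0. Qed.

Lemma tflipM f g : tflip (f * g) = tflip g * tflip f.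
Proof.
elim/skew_ind: f => [p d||f f' IH IH']; first last.
- by rewrite mulrDl !tflipD mulrDr IH IH'.
- by rewrite mul0r tflip0 mulr0.
elim/skew_ind: g => [q e||f f' IH IH']; first last.
- by rewrite mulrDr !tflipD mulrDl IH IH'.
- by rewrite mulr0 tflip0 mul0r.
rewrite skewM !tflipU skewM !act_shift1 opprD addrC; congr << _ *g _ >>.
rewrite rmorphM /= !shift1D /= mulrC; congr (_ * _).
by rewrite -{2}[d]opprK shift1K.
Qed.

Lemma tflipK : involutive tflip.
Proof.
elim/skew_ind=> [p d||f g Ef Eg]; rewrite ?tflip0 // !(tflipU, tflipD).
  by rewrite opprK shift1K.
by rewrite Ef Eg.
Qed.

Lemma tflipZ c : {morph tflip : f / c *: f}.
Proof.
elim/skew_ind=> [p d||f g Ef Eg].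
- by rewrite skewZ !tflipU skewZ linearZ.
- by rewrite scaler0 tflip0 scaler0.
- by rewrite scalerDr !tflipD scalerDr Ef Eg.
Qed.

Lemma tflip1 : tflip 1 = 1.
Proof. by rewrite [LHS]tflipU rmorph1 oppr0. Qed.

Lemma acc_left_skew l :
  monoid_generates l -> acc (left_ideal_in (predT : {pred S})).
Proof.
move=> /acc_right_skew; apply: (acc_left_anti tflipK tflipD tflipM).
by move=> x; rewrite !inE.
Qed.

Lemma poly_horner0 (p : {poly k}) : exists q, p = p.[0]%:P + 'X * q.
Proof.
elim/poly_ind: p => [|p c _]; first by exists 0; rewrite horner0 mulr0 addr0.
by exists p; rewrite hornerMXaddC mulr0 add0r addrC mulrC.
Qed.

Lemma spoly_horner0 (p : {poly k}) :
  exists q, spoly p = p.[0]%:A + spoly 'X * spoly q.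
Proof.
by have [q {1}->] := poly_horner0 p; exists q; rewrite spolyD spolyC spolyM.
Qed.

(** * The idealizer of aS *)

Section Idealizer.
Variable B : {pred S}.
Hypothesis BP : forall f, f \in B <-> exists c s, f = c%:A + spoly 'X * s.
Hypothesis i_inj : injective i.

Lemma idealizer_ideal s : spoly 'X * s \in B.
Proof. by apply/BP; exists 0, s; rewrite scale0r add0r. Qed.

Lemma idealizer_spoly p : spoly p \in B.
Proof. by apply/BP; have [q ->] := spoly_horner0 p; do 2!eexists. Qed.

Lemma i_neq0 d : d != 0 -> i d != 0.
Proof. by apply: contraNneq => id0; apply/eqP/i_inj; rewrite id0 raddf0. Qed.

(* Modulo aS the powers t^d are right eigenvectors of a, with distinct        *)
(* eigenvalues d.  A polynomial p with p(0) = 1 that kills the nonzero        *)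
(* eigenvalues in play therefore projects onto the eigenvalue 0, and the part *)
(* of J S left by this projection lies in J.                                  *)
Lemma right_span_project J y : right_ideal_in B J -> right_span J y ->
  exists p : {poly k}, p.[0] = 1 /\ J (y * spoly p).
Proof.
move=> [_ J0 JD JM].
have addQ u v : (exists p : {poly k}, p.[0] = 1 /\ J (u * spoly p)) ->
    (exists p : {poly k}, p.[0] = 1 /\ J (v * spoly p)) ->
    exists p : {poly k}, p.[0] = 1 /\ J ((u + v) * spoly p).
  move=> [p [p0 Jp]] [q [q0 Jq]]; exists (p * q); rewrite hornerM p0 q0 mulr1.
  split=> //; rewrite mulrDl {2}[p * q]mulrC !spolyM !mulrA.
  by apply: JD; apply: JM => //; apply: idealizer_spoly.
have Q0 : exists p : {poly k}, p.[0] = 1 /\ J (0 * spoly p).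
  by exists 1; rewrite hornerC mul0r.
elim=> [//|x s z Jx _]; apply: (addQ).
elim/skew_ind: s => [q d||s s' IH IH']; first last.
- by rewrite mulrDr; apply: (addQ).
- by rewrite mulr0.
have [->|/i_neq0 nz_d] := eqVneq d 0.
  exists 1; rewrite hornerC spoly1 mulr1; split=> //.
  exact/JM/Jx/idealizer_spoly.
(* Since t^d a = (a + d) t^d, the product t^d (1 - a/d) equals -(a/d) t^d, which lies in aS. *)
exists (1 - (i d)^-1%:P * 'X); rewrite !hornerE ?mulr0 ?subr0; split=> //.
rewrite -mulrA; apply: JM => //.
have -> : (<< q *g d >> : S) * spoly (1 - (i d)^-1%:P * 'X)
          = spoly 'X * << - ((i d)^-1%:P * q) *g d >>.
  rewrite !skewM addr0 add0r act0 act_shift1 rmorphB rmorph1 rmorphM /=.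
  rewrite shift1X shift1C [_%:P * (_ + _)]mulrDr -polyCM mulVf // opprD addrCA subrr addr0.
  by congr << _ *g _ >>; ring.
exact: idealizer_ideal.
Qed.

(* For u in K, the element t^d u is an eigenvector of a modulo S J, with      *)
(* eigenvalue -d.                                                             *)
Lemma left_span_project J K s :
  left_ideal_in B J -> (forall u, K u <-> J (spoly 'X * u)) -> left_span K s ->
  exists p : {poly k}, p.[0] = 1 /\ K (spoly p * s).
Proof.
move=> [_ J0 JD JM] KJ.
have XC p u : spoly 'X * (spoly p * u) = spoly p * (spoly 'X * u).
  by rewrite !mulrA -!spolyM mulrC.
have addQ u v : (exists p : {poly k}, p.[0] = 1 /\ K (spoly p * u)) ->
    (exists p : {poly k}, p.[0] = 1 /\ K (spoly p * v)) ->
    exists p : {poly k}, p.[0] = 1 /\ K (spoly p * (u + v)).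
  move=> [p [p0 /KJ Kp]] [q [q0 /KJ Kq]].
  exists (p * q); rewrite hornerM p0 q0 mulr1; split=> //; apply/KJ.
  rewrite mulrDr {1}[p * q]mulrC !spolyM -!mulrA mulrDr.
  by apply: JD; rewrite XC; apply: JM => //; apply: idealizer_spoly.
elim=> [|x t z /KJ Jx _].
  by exists 1; rewrite hornerC mulr0; split=> //; apply/KJ; rewrite mulr0.
apply: (addQ); elim/skew_ind: t => [q d||t t' IH IH']; first last.
- by rewrite mulrDl; apply: (addQ).
- by exists 1; rewrite hornerC mul0r mulr0; split=> //; apply/KJ; rewrite mulr0.
have [->|/i_neq0 nz_d] := eqVneq d 0.
  exists 1; rewrite hornerC spoly1 mul1r; split=> //; apply/KJ.
  by rewrite XC; apply/JM/Jx/idealizer_spoly.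
(* Here a (1 + a/d) q t^d = a (q/d) t^d a, an element of aS times a; the last a turns u in K into a
   u in J. *)
exists (1 + (i d)^-1%:P * 'X); rewrite !hornerE ?mulr0 ?addr0; split=> //.
apply/KJ; rewrite !mulrA.
have -> : spoly 'X * spoly (1 + (i d)^-1%:P * 'X) * << q *g d >>
          = spoly 'X * << (i d)^-1%:P * q *g d >> * spoly 'X.
  rewrite -spolyM !skewM addr0 !add0r !act0 act_shift1 shift1X.
  congr << _ *g _ >>.
  transitivity ('X * q * ((i d)^-1%:P * (i d)%:P + (i d)^-1%:P * 'X)); last by ring.
  by rewrite -polyCM mulVf //; ring.
by rewrite -mulrA; apply: JM => //; apply: idealizer_ideal.
Qed.

Lemma acc_right_idealizer :
  acc (right_ideal_in (predT : {pred S})) -> acc (right_ideal_in B).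
Proof.
move=> accS J idJ JS; have Jle := chain_le JS.
(* The right span of [JX n] is J_n aS. *)
pose JX n y := exists2 x, J n x & y = x * spoly 'X.
have JXS n y : JX n y -> JX n.+1 y by case=> x /JS Jx ->; exists x.
have [N HN] := accS _ (fun n => right_span_ideal (J n))
  (fun n => right_spanS (@JS n)).
have [M HM] := accS _ (fun n => right_span_ideal (JX n))
  (fun n => right_spanS (@JXS n)).
exists (maxn M N) => n le_n y; split; last exact: Jle.
have le_Mn := leq_trans (leq_maxl M N) le_n.
have le_Nn := leq_trans (leq_maxr M N) le_n.
have idJ' := idJ (maxn M N); have [_ J0 JD JM] := idJ'.
move=> Jy; have /(right_span_project idJ')[p [p0 Jp]] : right_span (J (maxn M N)) y.
  exact/(HN _ (leq_maxr M N))/(HN _ le_Nn)/right_span_sub.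
(* As 1 - p = a q, the remainder y (1 - p) is (y a) q, an element of J_n aS, which has already
   stabilised. *)
have [q] := spoly_horner0 (1 - p).
rewrite hornerD hornerN hornerC p0 subrr scale0r add0r => Eq.
rewrite -(mulr1 y) -spoly1 -(subrK p 1) spolyD mulrDr addrC Eq mulrA.
apply: (JD) => //.
have JX_sub z : right_span (JX (maxn M N)) z -> J (maxn M N) z.
  elim=> // _ s w [x Jx ->] _ Jw; apply: (JD) => //; rewrite -mulrA.
  exact/JM/Jx/idealizer_ideal.
apply/JX_sub/(HM _ (leq_maxl M N))/(HM _ le_Mn).
have [_ _ _ JXM] := right_span_ideal (JX n).
by apply: JXM => //; apply: right_span_sub; exists y.
Qed.

(** The set a K_n is the intersection of J_n with aS. After projecting s in K_n by p, the remainder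
    a (1 - p) s = a q (a s) lies in aS J_n; once S J_n = S J_N, this is aS J_N, which is inside
    J_N. *)
Lemma acc_left_idealizer :
  acc (left_ideal_in (predT : {pred S})) -> acc (left_ideal_in B).
Proof.
move=> accS J idJ JS; have Jle := chain_le JS.
pose K n s := J n (spoly 'X * s).
have KS n s : K n s -> K n.+1 s by apply: JS.
have [N1 H1] := accS _ (fun n => left_span_ideal (J n))
  (fun n => left_spanS (@JS n)).
have [N2 H2] := accS _ (fun n => left_span_ideal (K n))
  (fun n => left_spanS (@KS n)).
have [N [le_N1 le_N2]] : exists N, (N1 <= N)%N /\ (N2 <= N)%N.
  by exists (maxn N1 N2); rewrite leq_maxl leq_maxr.
have K_stable n : (N <= n)%N -> forall s, K n s -> K N s.
  move=> le_n s Ks; have idJ' := idJ N; have [_ J0 JD JM] := idJ'.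
  have [] := left_span_project (K := K N) (s := s) idJ' (fun u => iff_refl _).
    by apply/(H2 _ le_N2)/(H2 _ (leq_trans le_N2 le_n))/left_span_sub.
  move=> p [p0 Kp]; have [q] := spoly_horner0 (1 - p).
  rewrite hornerD hornerN hornerC p0 subrr scale0r add0r => Eq.
  rewrite -(mul1r s) -spoly1 -(subrK p 1) spolyD mulrDl addrC /K mulrDr.
  apply: (JD) => //; rewrite Eq -spolyM ['X * q]mulrC spolyM -mulrA.
  have XJ z : left_span (J N) z -> J N (spoly 'X * z).
    elim=> [|x t w Jx _ Jw]; first by rewrite mulr0.
    by rewrite mulrDr mulrA; apply: (JD) => //; apply/JM/Jx/idealizer_ideal.
  apply/XJ/(H1 _ le_N1)/(H1 _ (leq_trans le_N1 le_n)).
  by have [_ _ _ M] := left_span_ideal (J n); apply: M => //; apply: left_span_sub.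
(* aS has codimension at most one in B, so past N the chain J can still grow  *)
(* once.                                                                      *)
have [[n0 [x [c [s [Jx Ex nz_c]]]]]|noc] := pselect (exists n0 x c s,
    [/\ J n0 x, x = c%:A + spoly 'X * s & c != 0]).
  exists (maxn N n0) => n; rewrite geq_max => /andP[le_n le_n0] y.
  split; last by apply: Jle; rewrite geq_max le_n.
  move=> Jy; have [JB _ JD JM] := idJ n; have [_ _ JD' JM'] := idJ (maxn N n0).
  have [d [t Ey]] := (BP y).1 (JB _ Jy).
  have Bc e : e%:A \in B by rewrite -spolyC idealizer_spoly.
  rewrite -(subrK ((d / c)%:A * x) y); apply: JD'; last first.
    by apply: JM' => //; apply: Jle Jx; apply: leq_maxr.
  have E : y - (d / c)%:A * x = spoly 'X * (t - (d / c) *: s).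
    rewrite Ey Ex -scalerAl mul1r scalerDr scalerA divfK // opprD addrACA subrr.
    by rewrite add0r mulrBr -scalerAr.
  rewrite E; apply: (Jle N); first exact: leq_maxl.
  apply: (K_stable _ le_n); rewrite /K -E; apply: JD => //.
  rewrite -mulNr -scaleNr; apply: JM => //; exact: Jle Jx.
exists N => n le_n y; split; last exact: Jle.
move=> Jy; have [JB _ _ _] := idJ n; have [d [t Ey]] := (BP y).1 (JB _ Jy).
have d0 : d = 0.
  by apply: contrapT => /eqP nz_d; apply: noc; exists n, y, d, t.
move: Jy; rewrite Ey d0 scale0r add0r; exact: K_stable.
Qed.

End Idealizer.

(** * The algebras B_beta *)

Local Notation Bpred := (@Bbeta_pred k G i).

Section Image.
Variable beta : k.

Local Notation Bb := (Bpred beta).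

Lemma BbetaP f : f \in Bb <-> exists u : envelop (witt i), spec beta (phi u) = f.
Proof. exact: iff_sym (rwP (asboolP _)). Qed.

Lemma left_noetherian_Bbeta :
  acc (left_ideal_in Bb) -> left_noetherian (Bbeta i beta).
Proof.
move=> accB I idI IS.
pose J n f := exists2 y, I n y & val y = f.
have [n|n f [y /IS Iy <-]|N HN] := accB J; last 1 first.
- exists N => n le_n y; have := HN n le_n (val y).
  have JI m : J m (val y) <-> I m y.
    by split=> [[z Iz /val_inj <-]|Iy] //; exists y.
  by move=> H; split=> /JI/H/JI.
- have [I0 ID IM] := idI n; split=> [_ [y _ <-]||_ _ [y Iy <-] [z Iz <-]|b _ Bb0 [y Iy <-]].
  + exact: valP.
  + by exists 0.
  + by exists (y + z); rewrite ?rmorphD //; apply: ID.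
  + by exists (Sub b Bb0 * y); rewrite ?rmorphM ?SubK //; apply: IM.
- by exists y.
Qed.

Lemma right_noetherian_Bbeta :
  acc (right_ideal_in Bb) -> right_noetherian (Bbeta i beta).
Proof.
move=> accB I idI IS.
pose J n f := exists2 y, I n y & val y = f.
have [n|n f [y /IS Iy <-]|N HN] := accB J; last 1 first.
- exists N => n le_n y; have := HN n le_n (val y).
  have JI m : J m (val y) <-> I m y.
    by split=> [[z Iz /val_inj <-]|Iy] //; exists y.
  by move=> H; split=> /JI/H/JI.
- have [I0 ID IM] := idI n; split=> [_ [y _ <-]||_ _ [y Iy <-] [z Iz <-]|b _ Bb0 [y Iy <-]].
  + exact: valP.
  + by exists 0.
  + by exists (y + z); rewrite ?rmorphD //; apply: ID.
  + by exists (y * Sub b Bb0); rewrite ?rmorphM ?SubK //; apply: IM.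
- by exists y.
Qed.

Definition xgen (mu : G) : S := << 'X + (beta * i mu)%:P *g mu >>.

Lemma spec_phi_e mu : spec beta (phi_e i mu) = xgen mu.
Proof.
rewrite /phi_e specU rmorphD /= eva -mpoly.mul_mpolyC rmorphM /= evb evC.
by rewrite -polyCM mulrC.
Qed.

Lemma xgen_in mu : xgen mu \in Bb.
Proof. by apply/BbetaP; exists (ugen (witt_e i mu)); rewrite phi_gen spec_phi_e. Qed.

Lemma Bbeta_scale c f : f \in Bb -> c *: f \in Bb.
Proof. by move=> /BbetaP[u <-]; apply/BbetaP; exists (c *: u); rewrite phiZ specZ. Qed.

Lemma Bbeta_spoly p : spoly p \in Bb.
Proof.
elim/poly_ind: p => [|p c Bp]; first by rewrite /spoly monalgU0 rpred0.
rewrite spolyD spolyM spolyC rpredD ?Bbeta_scale ?rpred1 ?rpredM //.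
by have := xgen_in 0; rewrite /xgen raddf0 mulr0 addr0.
Qed.

(** [phi] reverses products, which is harmless because [P] is closed under products in either
    order. *)
Lemma Bbeta_ind (P : S -> Prop) : P 0 -> P 1 ->
  (forall f g, P f -> P g -> P (f + g)) -> (forall f g, P f -> P g -> P (f * g)) ->
  (forall c f, P f -> P (c *: f)) -> (forall mu, P (xgen mu)) ->
  forall f, f \in Bb -> P f.
Proof.
move=> P0 P1 PD PM PZ Px f /BbetaP[u <-].
have phi0 : phi (0 : envelop (witt i)) = 0.
  by apply: (addrI (phi (0 : envelop (witt i)))); rewrite -phiD !addr0.
have [gD gZ _] := ugen_lie (witt i).
elim/envelop_gen_ind: u => [x|||u v Pu Pv|u v Pu Pv|c u Pu].
- elim/witt_ind: x => [c mu||x y Px' Py].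
  + have -> : (<< c *g mu >> : witt i) = c *: witt_e i mu.
      by rewrite witt_scaleU mulr1.
    by rewrite gZ phiZ specZ phi_gen spec_phi_e; apply: PZ.
  + by rewrite -(scale0r 0) gZ scale0r phi0 spec0.
  + by rewrite gD phiD specD; apply: PD.
- by rewrite phi0 spec0.
- by rewrite phi1 spec1.
- by rewrite phiD specD; apply: PD.
- by rewrite phiM specM; apply: PM.
- by rewrite phiZ specZ; apply: PZ.
Qed.

End Image.

(** The generators are now a t^mu, and conversely a p t^d = p (a t^d) with p in B_0. *)
Lemma Bbeta0P f :
  f \in Bpred 0 <-> exists c s, f = c%:A + spoly 'X * s.
Proof.
split=> [|[c [s ->]]].
  move: f; apply: Bbeta_ind.
  - by exists 0, 0; rewrite scale0r mulr0 addr0.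
  - by exists 1, 0; rewrite scale1r mulr0 addr0.
  - move=> _ _ [c [s ->]] [d [t ->]]; exists (c + d), (s + t).
    by rewrite scalerDl mulrDr addrACA.
  - move=> _ _ [c [s ->]] [d [t ->]].
    exists (c * d), (c *: t + s * (d%:A + spoly 'X * t)).
    rewrite [LHS]mulrDl -[_ * s * _]mulrA -scalerAl mul1r [spoly _ * (_ + _)]mulrDr.
    by rewrite addrA scalerDr scalerA -scalerAr.
  - move=> e _ [c [s ->]]; exists (e * c), (e *: s).
    by rewrite scalerDr scalerA -scalerAr.
  - move=> mu; exists 0, (tpow mu).
    by rewrite scale0r add0r /xgen mul0r addr0 skewE.
rewrite rpredD ?Bbeta_scale ?rpred1 //.
elim/skew_ind: s => [p d||s t Bs Bt]; last 2 first.
- by rewrite mulr0 rpred0.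
- by rewrite mulrDr rpredD.
rewrite skewE mulrA -spolyM mulrC spolyM -mulrA rpredM ?Bbeta_spoly //.
by have := xgen_in 0 d; rewrite /xgen mul0r addr0 skewE.
Qed.

(** On generators, t^{-mu} (a + beta mu) = (a + (1 - beta)(-mu)) t^{-mu}. *)
Lemma tflip_Bbeta beta f :
  (tflip f \in Bpred beta) = (f \in Bpred (1 - beta)).
Proof.
have sub b g : g \in Bpred b -> tflip g \in Bpred (1 - b).
  move: g; apply: Bbeta_ind.
  - by rewrite tflip0 rpred0.
  - by rewrite tflip1 rpred1.
  - by move=> g h Bg Bh; rewrite tflipD rpredD.
  - by move=> g h Bg Bh; rewrite tflipM rpredM.
  - by move=> c g Bg; rewrite tflipZ Bbeta_scale.
  - move=> mu; have := xgen_in (1 - b) (- mu).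
    rewrite /xgen tflipU rmorphD /= shift1X shift1C raddfN.
    by rewrite -addrA -polyCD (_ : - _ + _ = (1 - b) * - i mu) //; ring.
by apply/idP/idP => [/sub|/sub]; rewrite ?tflipK ?subKr.
Qed.

(** B_beta contains k[a], so it is enough to find each t^d in it; the constant 2 d^2 beta (1 - beta)
    must be inverted. *)
Lemma Bbeta_full beta f : 2%:R != 0 :> k -> injective i ->
  beta != 0 -> beta != 1 -> f \in Bpred beta.
Proof.
move=> nz2 i_inj nz_b nz_b1; elim/skew_ind: f => [p d||f g Bf Bg]; last 2 first.
- exact: rpred0.
- exact: rpredD.
rewrite skewE rpredM ?Bbeta_spoly //.
have [->|/(i_neq0 i_inj) nz_d] := eqVneq d 0; first by rewrite rpred1.
pose c := 2%:R * i d ^+ 2 * beta * (1 - beta).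
have nz_c : c != 0.
  by rewrite !mulf_neq0 ?expf_neq0 // subr_eq0 eq_sym.
(* x_(2d) x_(-d) and (a + 2d) x_d agree up to the constant c.                 *)
have -> : tpow d = c^-1 *: (xgen beta (d + d) * xgen beta (- d)
                            - spoly ('X + (2%:R * i d)%:P) * xgen beta d).
  rewrite /xgen !skewM act0 add0r addrK act_shift1 rmorphD /= shift1X shift1C.
  rewrite -monalgUB skewZ; congr << _ *g _ >>.
  have <- : c^-1 *: c%:P = 1 by rewrite -mul_polyC -polyCM mulVf.
  rewrite raddfN [i (_ + _)]raddfD; congr (_ *: _).
  by rewrite /c !(polyCD, polyCM, polyCN, polyC_exp, polyC1); ring.
by rewrite Bbeta_scale // rpredB ?rpredM ?xgen_in ?Bbeta_spoly.
Qed.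

Lemma noetherian_Bbeta beta l : 2%:R != 0 :> k -> injective i ->
  monoid_generates l ->
  left_noetherian (Bbeta i beta) /\ right_noetherian (Bbeta i beta).
Proof.
move=> nz2 i_inj gen_l.
have accL := acc_left_skew gen_l; have accR := acc_right_skew gen_l.
have accL0 := acc_left_idealizer Bbeta0P i_inj accL.
have accR0 := acc_right_idealizer Bbeta0P i_inj accR.
suff [aL aR] : acc (left_ideal_in (Bpred beta)) /\
    acc (right_ideal_in (Bpred beta)).
  by split; [exact: left_noetherian_Bbeta | exact: right_noetherian_Bbeta].
have [->|nz_b] := eqVneq beta 0; first by [].
have [->|nz_b1] := eqVneq beta 1.
  have flipB f : (tflip f \in Bpred 0) = (f \in Bpred 1).
    by rewrite tflip_Bbeta subr0.
  split; first exact: (acc_left_anti tflipK tflipD tflipM flipB).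
  exact: (acc_right_anti tflipK tflipD tflipM flipB).
have Bfull f : f \in Bpred beta by apply: Bbeta_full.
split=> J idJ; [apply: accL => n | apply: accR => n].
  by have [_ J0 JD JM] := idJ n; split=> // b x _; apply: JM.
by have [_ J0 JD JM] := idJ n; split=> // b x _; apply: JM.
Qed.

End SkewLaurent.

(** * From group generators to monoid generators *)

Lemma fin_gen_monoid (V : zmodType) (Gam : zmodClosed V) : fin_gen Gam ->
  exists l : seq (zsub Gam), monoid_generates l.
Proof.
case=> s sP; have sG (j : 'I_(size s)) : s`_j \in Gam.
  apply/sP; exists (fun j' => (j' == j)%:Z).
  rewrite (bigD1 j) //= eqxx mulr1z big1 ?addr0 // => j' /negPf->.
  by rewrite mulr0z.
pose u (j : 'I_(size s)) : zsub Gam := Sub s`_j (sG j).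
exists ([seq u j | j : 'I_(size s)] ++ [seq - u j | j : 'I_(size s)]).
move=> P P0 PD d; have [c Ec] := (sP (val d)).1 (valP d).
have {Ec} -> : d = \sum_j u j *~ c j.
  apply: val_inj; rewrite Ec raddf_sum; apply: eq_bigr => j _.
  by rewrite raddfMz.
(* [Q] is closed under sums, whereas [P] itself is only known to be stable under adding a listed
   generator. *)
pose Q x := forall e, P e -> P (x + e).
have Q0 : Q 0 by move=> e; rewrite add0r.
have QD x y : Q x -> Q y -> Q (x + y).
  by move=> Qx Qy e /Qy/Qx; rewrite addrA.
have QMn x n : Q x -> Q (x *+ n).
  by move=> Qx; elim: n => // n IHn; rewrite mulrS; apply: QD.
suff : Q (\sum_j u j *~ c j) by move/(_ 0 P0); rewrite addr0.
elim/big_ind: _ => // j _; case: (c j) => n.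
  by apply: QMn => e; apply: PD; rewrite mem_cat image_f.
rewrite NegzE mulrNz -mulNrz; apply: QMn => e; apply: PD.
by rewrite mem_cat (image_f (fun j => - u j)) ?orbT.
Qed.

Theorem proposition4p6 (k : closedFieldType) (hchar : [pchar k] =i pred0)
    (Gam : zmodClosed k) (hGam : fin_gen Gam) (beta : k) :
  left_noetherian (Bbeta (zsub_val Gam) beta)
  /\ right_noetherian (Bbeta (zsub_val Gam) beta).
Proof.
have [l gen_l] := fin_gen_monoid hGam.
apply: noetherian_Bbeta gen_l; last exact: val_inj.
by have := hchar 2; rewrite !inE /= => ->.
Qed.
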